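(* Let $\mathcal{B}$ be a double bridge graph and let $p\in(2,6)$. For every $\mu>0$, there exists a bound state $u$ of mass $\mu$ for the everywhere nonlinear NLS problem on $\mathcal{B}$ which is symmetric with respect to the axis $r$ of $\mathcal{B}$ and everywhere positive on $\mathcal{B}$.
   Context: Double bridge graph. $\mathcal{B}$ is the metric graph with two vertices $\mathrm{v}_-,\mathrm{v}_+$, two bounded edges (of arbitrary positive lengths), each joining $\mathrm{v}_-$ to $\mathrm{v}_+$, and two half-lines (copies of $[0,+\infty)$), one attached by its origin to $\mathrm{v}_-$ and the other to $\mathrm{v}_+$. Symmetry with respect to the axis $r$ means invariance under the isometry of $\mathcal{B}$ that exchanges $\mathrm{v}_-$ with $\mathrm{v}_+$, exchanges the two half-lines, and maps each bounded edge onto itself by reflection about its midpoint. Function spaces. Each edge $e$ of a metric graph $\mathcal{G}$ is identified with an interval $I_e$ ($[0,\ell_e]$ for a bounded edge, $[0,+\infty)$ for a half-line) with coordinate $x_e$; a function $u:\mathcal{G}\to\mathbb{C}$ is a family $\{u_e\}$ with $u_e:I_e\to\mathbb{C}$. $\|u\|_{L^2(\mathcal{G})}^2=\sum_e\|u_e\|_{L^2(I_e)}^2$. $H^1(\mathcal{G})$ is the space of continuous $u:\mathcal{G}\to\mathbb{C}$ (components agree at common vertices) with $u_e\in H^1(I_e;\mathbb{C})$ for every edge $e$, and $H^1_\mu(\mathcal{G})=\{u\in H^1(\mathcal{G}):\|u\|_{L^2(\mathcal{G})}^2=\mu\}$. Bound states of the everywhere nonlinear problem. A bound state of mass $\mu$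 for the everywhere nonlinear problem on $\mathcal{G}$ is a function $u\in H^1_\mu(\mathcal{G})$ for which there is $\lambda\in\mathbb{R}$ such that $u_e''+|u_e|^{p-2}u_e=\lambda u_e$ on every edge $e$ (bounded or half-line), and at every vertex $\mathrm{v}$ the Kirchhoff condition $\sum_{e\succ\mathrm{v}}\frac{du_e}{dx_e}(\mathrm{v})=0$ holds, where the sum is over all edges incident at $\mathrm{v}$ and $\frac{du_e}{dx_e}(\mathrm{v})$ is $u_e'(0)$ or $-u_e'(\ell_e)$ according to whether $x_e$ equals $0$ or $\ell_e$ at $\mathrm{v}$. *)

(* Defs.v *)
From HB Require Import structures.
From mathcomp Require Import all_boot all_order all_algebra.
From mathcomp Require Import all_classical all_reals all_analysis.
From mathcomp Require Import complex.

Set Implicit Arguments.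
Unset Strict Implicit.
Unset Printing Implicit Defensive.

Import Order.TTheory GRing.Theory Num.Theory.
Import numFieldNormedType.Exports.

Local Open Scope classical_set_scope.
Local Open Scope ring_scope.
Local Open Scope complex_scope.

Section OneInterval.
Context {R : realType}.
Implicit Types (I : set R) (f g : R -> R[i]).

(* Derivative of f relative to I: one-sided at an endpoint belonging to I.
   R[i]^o only selects the usual topology of the complex numbers. *)
Definition is_derivative_on I f g : Prop :=
  forall x, I x ->
    (fun y => (f y - f x) / (y - x)%:C : R[i]^o) @ within I x^'
      --> (g x : R[i]^o).

Definition sqL2norm I f : \bar R :=
  (\int[lebesgue_measure]_(x in I) (Normc.normc (f x) ^+ 2)%:E)%E.

Definition L2 I f : Prop :=
  [/\ measurable_fun I (fun x => complex.Re (f x)),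
      measurable_fun I (fun x => complex.Im (f x)) &
      (sqL2norm I f < +oo)%E].

Definition complex_integral I f : R[i] :=
  (\int[lebesgue_measure]_(x in I) complex.Re (f x))%R +i*
  (\int[lebesgue_measure]_(x in I) complex.Im (f x))%R.

(* Smooth, with compact support in the interior of I. *)
Definition test_function I (phi : R -> R) : Prop :=
  (forall n x, derivable (derive1n n phi) x 1) /\
  (exists K : set R, [/\ compact K, K `<=` I° &
     forall x, ~ K x -> phi x = 0]).

Definition weak_derivative I f g : Prop :=
  forall phi : R -> R, test_function I phi ->
    complex_integral I (fun x => f x * (derive1 phi x)%:C) =
    - complex_integral I (fun x => g x * (phi x)%:C).

Definition H1 I f : Prop :=
  L2 I f /\ exists g, L2 I g /\ weak_derivative I f g.

End OneInterval.

(* A bounded edge [b] has coordinate 0 at [edge_tail b] and [len b] at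
   [edge_head b]; a half-line [h] has coordinate 0 at [half_line_root h]. *)
Record metric_graph (R : realType) := MetricGraph {
  vertex : finType;
  bounded_edge : finType;
  half_line : finType;
  len : bounded_edge -> {posnum R};
  edge_tail : bounded_edge -> vertex;
  edge_head : bounded_edge -> vertex;
  half_line_root : half_line -> vertex
}.

Section MetricGraph.
Context {R : realType}.
Variable G : metric_graph R.

Definition edge : finType := (bounded_edge G + half_line G)%type.

Definition edge_interval (e : edge) : set R :=
  match e with
  | inl b => `[0, (len b)%:num]
  | inr _ => `[0, +oo[
  end.

(* A function on G is a family u : edge -> R -> R[i]; only the values of u e
   on edge_interval e are meaningful. *)

Definition continuous_on_graph (u : edge -> R -> R[i]) : Prop :=
  (forall e, {within edge_interval e, continuous (u e : R -> R[i]^o)}) /\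
  (exists c : vertex G -> R[i],
    [/\ forall b, u (inl b) 0 = c (edge_tail b),
        forall b, u (inl b) (len b)%:num = c (edge_head b) &
        forall h, u (inr h) 0 = c (half_line_root h)]).

Definition mass (u : edge -> R -> R[i]) : \bar R :=
  (\sum_(e : edge) sqL2norm (edge_interval e) (u e))%E.

Definition graph_H1 (u : edge -> R -> R[i]) : Prop :=
  continuous_on_graph u /\ forall e, H1 (edge_interval e) (u e).

Definition graph_H1_mass (mu : R) (u : edge -> R -> R[i]) : Prop :=
  graph_H1 u /\ mass u = mu%:E.

(* A loop at v contributes both of its ends. *)
Definition kirchhoff (du : edge -> R -> R[i]) (v : vertex G) : Prop :=
  \sum_(b | edge_tail b == v) du (inl b) 0
  - \sum_(b | edge_head b == v) du (inl b) (len b)%:num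
  + \sum_(h | half_line_root h == v) du (inr h) 0 = 0.

Definition bound_state (p mu : R) (u : edge -> R -> R[i]) : Prop :=
  graph_H1_mass mu u /\
  exists (lambda : R) (du d2u : edge -> R -> R[i]),
    [/\ forall e, is_derivative_on (edge_interval e) (u e) (du e),
        forall e, is_derivative_on (edge_interval e) (du e) (d2u e),
        forall e x, edge_interval e x ->
          d2u e x + (Normc.normc (u e x) `^ (p - 2))%:C * u e x
          = lambda%:C * u e x &
        forall v, kirchhoff du v].

(* In R[i], 0 < z means that z is real and positive. *)
Definition everywhere_positive (u : edge -> R -> R[i]) : Prop :=
  forall e x, edge_interval e x -> 0 < u e x.

End MetricGraph.

Section DoubleBridge.
Context {R : realType}.
Variables l1 l2 : {posnum R}.

(* The vertices v_- and v_+ are [false] and [true]. The two bounded edges,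
   [false] of length l1 and [true] of length l2, run from v_- to v_+; the
   half-line [h] starts at the vertex [h]. *)
Definition double_bridge : metric_graph R := {|
  vertex := bool;
  bounded_edge := bool;
  half_line := bool;
  len := fun b => if b then l2 else l1;
  edge_tail := fun=> false;
  edge_head := fun=> true;
  half_line_root := id
|}.

Definition axis_reflection (q : edge double_bridge * R) :
    edge double_bridge * R :=
  match q with
  | (inl b, x) => (inl b, (len b)%:num - x)
  | (inr h, x) => (inr (~~ h), x)
  end.

Definition axis_symmetric (u : edge double_bridge -> R -> R[i]) : Prop :=
  forall (e : edge double_bridge) (x : R), edge_interval e x ->
    let q := axis_reflection (e, x) in u q.1 q.2 = u e x.

End DoubleBridge.

(* Main.v *)
Require Import Defs.
From mathcomp Require Import all_boot all_order all_algebra.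
From mathcomp Require Import all_classical all_reals all_analysis.
From mathcomp Require Import complex.
From mathcomp Require Import measurable_realfun ring lra.
Import Order.TTheory GRing.Theory Num.Theory.
Import numFieldNormedType.Exports.

Set Implicit Arguments.
Unset Strict Implicit.
Unset Printing Implicit Defensive.

Local Open Scope classical_set_scope.
Local Open Scope ring_scope.

(** The symmetry halves the graph: what is left is a half-line and two segments
    that issue from one vertex, the far ends of the segments being the midpoints
    of the bounded edges, where the derivative has to vanish.  With
    lambda = r ^ 2, kappa = (p - 2) / 2 and u x = r ^ (1 / kappa) * w (r * x) the
    equation becomes w'' = w - w ^ (p - 1).  On the half-line w is a decreasing
    piece of the soliton phi, explicit in terms of the hyperbolic cosine, and it
    starts at phi t0 with slope - sigma, where sigma = - phi' t0 > 0.  The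
    Kirchhoff condition says that the outgoing slopes on the two segments add up
    to sigma; let them be k * sigma on the longer segment and (1 - k) * sigma on
    the shorter one.  The solution on the longer segment is followed until its
    first maximum, at time T (t0, k).  This time must be r times the length of
    the segment, so it determines r and the rescaled length of the shorter
    segment.

    Two unknowns (t0, k) remain, and two equations: the derivative on the shorter
    segment vanishes at its end, and the mass is mu.  Let k range over [1/2, 2].
    - At k = 1/2 the same solution runs on both segments and the shorter one ends
      no later than the maximum, so the derivative at its end is nonnegative.
    - At k = 2 the solution on the shorter segment starts with slope - sigma: it
      is the soliton tail again, and its derivative is negative everywhere.
    - When t0 tends to 0 the time T tends to 0, and the mass, which is
      r ^ (2 / kappa - 1) times a bounded quantity, tends to 0: its exponent is
      positive because p < 6.
    - When t0 tends to infinity so does T, while the maximum on the longer segment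
      stays at least 1 and keeps a fixed amount of rescaled mass around it: the
      mass tends to infinity.
    These are the sign conditions of the Poincare-Miranda theorem on a rectangle
    (poincare_miranda, deduced from a version of Sperner's lemma for grids), and a
    common zero of the two functions is a solution (exists_profile).  It has
    k < 2, so the solution on the shorter segment has negative energy and cannot
    vanish; on the longer segment the solution increases up to its maximum.  Hence
    both are positive, and the reflection at the midpoints gives the other half of
    each bounded edge.

    Solutions exist globally and depend continuously on their initial data because
    the nonlinearity is replaced by a Lipschitz one above a large threshold, which
    conservation of energy shows is never reached. *)

(** * Derivatives and antiderivatives of real functions *)

Section Calculus.
Context {R : realType}.
Implicit Types (f g F : R -> R) (a b x : R).

Lemma is_derive_cstf (k : R) x : is_derive x 1 (fun _ : R => k) 0.
Proof. exact: is_derive_cst. Qed.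

Lemma is_deriveDf f g x a b : is_derive x 1 f a -> is_derive x 1 g b ->
  is_derive x 1 (fun t => f t + g t) (a + b).
Proof. by move=> df dg; apply: is_deriveD. Qed.

Lemma is_deriveBf f g x a b : is_derive x 1 f a -> is_derive x 1 g b ->
  is_derive x 1 (fun t => f t - g t) (a - b).
Proof. by move=> df dg; apply: is_deriveB. Qed.

Lemma is_deriveMf f g x a b : is_derive x 1 f a -> is_derive x 1 g b ->
  is_derive x 1 (fun t => f t * g t) (a * g x + f x * b).
Proof.
move=> df dg.
have h : is_derive x 1 (f * g) (f x *: b + g x *: a) by exact: is_deriveM.
apply: (is_derive_eq h).
by rewrite /GRing.scale /= addrC mulrC.
Qed.

Lemma is_deriveZf f k x a : is_derive x 1 f a ->
  is_derive x 1 (fun t => k * f t) (k * a).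
Proof.
move=> df.
have := is_deriveMf (is_derive_cst k x 1) df.
by rewrite mul0r add0r.
Qed.

Lemma is_derive_sqr f x a : is_derive x 1 f a ->
  is_derive x 1 (fun t => f t ^+ 2) (2 * f x * a).
Proof.
move=> df; have := is_deriveMf df df.
have -> : (fun t => f t * f t) = (fun t => f t ^+ 2) by apply/funext => t; rewrite expr2.
by move=> h; apply: (is_derive_eq h); ring.
Qed.

Lemma is_derive_compf f g x a b : is_derive (g x) 1 f a -> is_derive x 1 g b ->
  is_derive x 1 (fun t => f (g t)) (a * b).
Proof.
by move=> df dg; exact: (@is_derive1_comp _ f g x a b df dg).
Qed.

Lemma is_derive_linear r x : is_derive x 1 (fun t : R => r * t) r.
Proof. by have := is_deriveZf r (is_derive_id x 1); rewrite mulr1. Qed.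

Lemma is_derive_affine r s x : is_derive x 1 (fun t : R => r * t + s) r.
Proof.
have := is_deriveDf (is_derive_linear r x) (is_derive_cst s x 1).
by rewrite addr0.
Qed.

Lemma is_derive_expRM r x :
  is_derive x 1 (fun t : R => expR (r * t)) (r * expR (r * x)).
Proof.
rewrite mulrC.
exact: (@is_derive_compf expR (fun t => r * t) x _ _ (is_derive_expR (r * x))
  (is_derive_linear r x)).
Qed.

Lemma is_derive_continuous f x a : is_derive x 1 f a -> {for x, continuous f}.
Proof. by move=> [df _]; apply/differentiable_continuous/derivable1_diffP. Qed.

Lemma is_derive_within f g a b :
  (forall x, a <= x <= b -> is_derive x 1 f (g x)) ->
  {within `[a, b], continuous f}.
Proof.
move=> df; apply: continuous_in_subspaceT => x /set_mem /=.
by rewrite in_itv /= => /df /is_derive_continuous.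
Qed.

Lemma derive_ge0_le f g a b : a <= b ->
  (forall x, a <= x <= b -> is_derive x 1 f (g x)) ->
  (forall x, a <= x <= b -> 0 <= g x) -> f a <= f b.
Proof.
move=> ab df g0.
have [c cab E] : exists2 c, c \in `[a, b]%R & f b - f a = g c * (b - a).
  apply: MVT_segment => //; last exact: is_derive_within df.
  by move=> x /[!in_itv] /= /andP[/ltW ax /ltW xb]; apply: df; rewrite ax xb.
rewrite -subr_ge0 E mulr_ge0 ?subr_ge0 //; apply: g0.
by move: cab; rewrite in_itv.
Qed.

Lemma derive_le f g F G a b : a <= b ->
  (forall x, a <= x <= b -> is_derive x 1 f (g x)) ->
  (forall x, a <= x <= b -> is_derive x 1 F (G x)) ->
  (forall x, a <= x <= b -> g x <= G x) -> f b - f a <= F b - F a.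
Proof.
move=> ab df dF gG.
have : F a - f a <= F b - f b.
  apply: (@derive_ge0_le (fun t => F t - f t) (fun t => G t - g t)) => // x xab.
    by apply: is_deriveBf; [apply: dF|apply: df].
  by rewrite subr_ge0 gG.
lra.
Qed.

Lemma derive_norm_le f g F G a b : a <= b ->
  (forall x, a <= x <= b -> is_derive x 1 f (g x)) ->
  (forall x, a <= x <= b -> is_derive x 1 F (G x)) ->
  (forall x, a <= x <= b -> `|g x| <= G x) -> `|f b - f a| <= F b - F a.
Proof.
move=> ab df dF gG; rewrite ler_norml; apply/andP; split; last first.
  by apply: (derive_le ab df dF) => x /gG; rewrite ler_norml => /andP[].
have := @derive_le (fun t => -1 * f t) (fun t => -1 * g t) F G a b ab _ dF _.
move=> h; have {h}: -1 * f b - -1 * f a <= F b - F a.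
  apply: h => x xab; first by apply/is_deriveZf/df.
  by have := gG x xab; rewrite ler_norml => /andP[]; lra.
lra.
Qed.

Lemma derive_gt0_lt f g a b : a < b ->
  (forall x, a <= x <= b -> is_derive x 1 f (g x)) ->
  (forall x, a < x < b -> 0 < g x) -> f a < f b.
Proof.
move=> ab df g0.
have [c cab E] : exists2 c, c \in `]a, b[%R & f b - f a = g c * (b - a).
  apply: MVT => //; last exact: is_derive_within df.
  by move=> x /[!in_itv] /= /andP[/ltW ax /ltW xb]; apply: df; rewrite ax xb.
rewrite -subr_gt0 E mulr_gt0 ?subr_gt0 //; apply: g0.
by move: cab; rewrite in_itv.
Qed.

(** Continuity in the form in which a single radius can be extracted and used. *)
Lemma continuous_near f x e : {for x, continuous f} -> 0 < e ->
  exists2 r, 0 < r & forall y, `|x - y| < r -> `|f x - f y| < e.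
Proof.
move=> cf e0.
have : \forall y \near x, `|f x - f y| < e by exact: (@cvgr_dist_lt _ _ _ _ _ _ _ cf _ e0).
by move=> /nbhs_ballP[r /= r0 h]; exists r.
Qed.

Lemma near_dist_lt x e : 0 < e -> \forall y \near x, `|x - y| < e.
Proof. by move=> e0; apply: (@nbhsx_ballx R R x e). Qed.

(** Normalized to vanish at 0.  The integral starts at a point that depends on
    [x] and lies to the left of both 0 and [x], because a set integral is not
    oriented; this gives an antiderivative on the whole line at once. *)
Definition prim f x : R :=
  (\int[lebesgue_measure]_(t in `[(- (`|x| + 1)), x]) f t)%R -
  (\int[lebesgue_measure]_(t in `[(- (`|x| + 1)), 0]) f t)%R.

Lemma continuous_itv_integrable f a b : continuous f ->
  (lebesgue_measure : measure _ R).-integrable `[a, b] (EFin \o f).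
Proof.
move=> cf; apply: continuous_compact_integrable; first exact: segment_compact.
exact: continuous_subspaceT.
Qed.

Lemma continuous_itv_integrable_oc f a b : continuous f ->
  (lebesgue_measure : measure _ R).-integrable `]a, b] (EFin \o f).
Proof.
move=> cf; apply: integrableS (continuous_itv_integrable a b cf) => //.
exact: subset_itv_oc_cc.
Qed.

(** By additivity the base point may be moved further left, so that near a given
    point one fixed base point serves. *)
Lemma prim_base f L x : continuous f -> `|x| + 1 <= L ->
  prim f x = (\int[lebesgue_measure]_(t in `[(- L), x]) f t)%R -
             (\int[lebesgue_measure]_(t in `[(- L), 0]) f t)%R.
Proof.
move=> cf xL; rewrite /prim.
have split y : - (`|x| + 1) <= y ->
   (\int[lebesgue_measure]_(t in `[(- L), y]) f t)%R -
   (\int[lebesgue_measure]_(t in `[(- L), - (`|x| + 1)]) f t)%R =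
   (\int[lebesgue_measure]_(t in `[(- (`|x| + 1))%R, y]) f t)%R.
  move=> yx; rewrite Rintegral_itvB ?bnd_simp //.
  - by rewrite Rintegral_itv_obnd_cbnd //; apply: continuous_itv_integrable_oc.
  - exact: continuous_itv_integrable.
  - by rewrite lerN2.
rewrite -(split x) -?(split 0); first by ring.
- by rewrite oppr_le0 addr_ge0.
- by rewrite lerNl; have := ler_norm (- x); rewrite normrN; lra.
Qed.

Lemma prim0 f : prim f 0 = 0.
Proof. by rewrite /prim subrr. Qed.

Lemma is_derive_prim f x : continuous f -> is_derive x 1 (prim f) (f x).
Proof.
move=> cf; set L := `|x| + 2.
have [dF F'] : derivable (fun y => \int[lebesgue_measure]_(t in `[(- L), y]) f t)%R x 1
   /\ derive1 (fun y => \int[lebesgue_measure]_(t in `[(- L), y]) f t)%R x = f x.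
  apply: (@continuous_FTC1_closed _ f (- L) x (x + 1)) => //.
  - by rewrite ltrDl.
  - exact: continuous_itv_integrable.
  - by rewrite ltrNl /L; have := ler_norm (- x); rewrite normrN; lra.
  - exact: cf.
have dI : is_derive x 1 (fun y => \int[lebesgue_measure]_(t in `[(- L), y]) f t)%R (f x).
  by rewrite -F' derive1E; apply: derivableP.
have := is_deriveBf dI
  (is_derive_cst (\int[lebesgue_measure]_(t in `[(- L), 0]) f t)%R x 1).
rewrite subr0; apply: near_eq_is_derive.
near=> y; rewrite (@prim_base f L) //.
have : `|y - x| < 1.
  by rewrite distrC; near: y; apply: near_dist_lt; rewrite ltr01.
have := ler_normD (y - x) x; rewrite subrK /L; lra.
Unshelve. all: by end_near. Qed.

Lemma continuous_prim f : continuous f -> continuous (prim f).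
Proof. by move=> cf x; apply: is_derive_continuous; exact: is_derive_prim. Qed.

End Calculus.

(** * The equation y'' = g y with g Lipschitz *)

Section Newton.
Context {R : realType}.
Implicit Types (t T : R).

Let le_drop (X Y Z : R) : 0 <= Z -> X <= Y - Z -> X <= Y.
Proof. by move=> ? ?; lra. Qed.

(** [D * exp (- K x)] is nonincreasing. *)
Lemma gronwall (D d : R -> R) K t : 0 <= t ->
  (forall x : R, 0 <= x <= t -> is_derive x 1 D (d x)) ->
  (forall x : R, 0 <= x <= t -> d x <= K * D x) -> D t <= D 0 * expR (K * t).
Proof.
move=> t0 dD dK.
have dE (x : R) : is_derive x 1 (fun s : R => expR (- K * s)) (- K * expR (- K * x)).
  exact: is_derive_expRM.
have := @derive_ge0_le R (fun x => 0 - D x * expR (- K * x))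
  (fun x => 0 - (d x * expR (- K * x) + D x * (- K * expR (- K * x)))) 0 t t0.
rewrite mulr0 expR0 mulr1 !sub0r lerN2 => h.
have {h}: D t * expR (- K * t) <= D 0.
  apply: h => x xt.
    apply: is_deriveBf.
    by apply: is_deriveMf => //; apply: dD.
  have := dK x xt; have := expR_gt0 (- K * x); nra.
by rewrite mulNr expRN ler_pdivrMr ?expR_gt0.
Qed.

Lemma half_expn_lt (C e : R) : 0 < e -> exists n, C / 2 ^+ n < e.
Proof.
move=> e0; exists (Num.truncn (C / e)).+1.
rewrite ltr_pdivrMr ?exprn_gt0 // mulrC -ltr_pdivrMr //.
apply: (lt_trans (truncnS_gt _)).
by rewrite -natrX ltr_nat ltn_expl.
Qed.

Lemma half_expn_eq0 (x C : R) : (forall n, `|x| <= C / 2 ^+ n) -> x = 0.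
Proof.
move=> h; apply/eqP; apply/negPn/negP; rewrite -normr_gt0 => x0.
by have [n] := half_expn_lt C x0; rewrite ltNge h.
Qed.

(** The limit is the supremum of the numbers [u n - 2 C / 2 ^ n], which increase
    and stay below the decreasing numbers [u n + 2 C / 2 ^ n]. *)
Lemma geometric_limit (u : nat -> R) C :
  (forall n, `|u n.+1 - u n| <= C / 2 ^+ n) ->
  exists l, forall n, `|l - u n| <= 2 * C / 2 ^+ n.
Proof.
move=> hu; pose lo n := u n - 2 * C / 2 ^+ n; pose hi n := u n + 2 * C / 2 ^+ n.
have e2 n : 2 * C / 2 ^+ n.+1 = C / 2 ^+ n.
  by rewrite exprS invfM; field; rewrite expf_neq0.
have e1 n : 2 * C / 2 ^+ n = C / 2 ^+ n + C / 2 ^+ n by ring.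
have loS n : lo n <= lo n.+1.
  by rewrite /lo e2 e1; have := hu n; rewrite ler_norml => /andP[]; lra.
have hiS n : hi n.+1 <= hi n.
  by rewrite /hi e2 e1; have := hu n; rewrite ler_norml => /andP[]; lra.
have lohi n : lo n <= hi n.
  by rewrite /lo /hi e1; have := le_trans (normr_ge0 _) (hu n); lra.
have lom n k : lo n <= lo (n + k)%N.
  by elim: k => [|k IH]; rewrite ?addn0 // addnS (le_trans IH).
have him n k : hi (n + k)%N <= hi n.
  by elim: k => [|k IH]; rewrite ?addn0 // addnS (le_trans _ IH).
have lh n m : lo n <= hi m.
  by apply: le_trans (lom n m) (le_trans (lohi _) _); rewrite addnC him.
have sl : has_sup (range lo).
  by split; [exists (lo 0%N); exists 0%N|exists (hi 0%N) => _ [n _ <-]].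
exists (sup (range lo)) => n; rewrite ler_norml; apply/andP; split.
  have : lo n <= sup (range lo) by apply: sup_upper_bound => //; exists n.
  by rewrite /lo; lra.
have : sup (range lo) <= hi n.
  by apply: ge_sup; [case: sl|move=> _ [m _ <-]].
by rewrite /hi; lra.
Qed.

Definition newton (g : R -> R) T (y z : R -> R) := forall t, 0 <= t <= T ->
  is_derive t 1 y (z t) /\ is_derive t 1 z (g (y t)).

Section Lipschitz.
Variables (g : R -> R) (L : R).
Hypothesis L0 : 0 <= L.
Hypothesis gL : forall u v, `|g u - g v| <= L * `|u - v|.

Lemma lipschitz_continuous : continuous g.
Proof.
move=> x; apply/cvgrPdist_lt => e e0.
near=> y; apply: le_lt_trans (gL _ _) _.
have : `|(x : R) - y| < e / (L + 1).
  by near: y; apply: near_dist_lt; rewrite divr_gt0 // ltr_wpDl.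
rewrite ltr_pdivlMr; last by rewrite ltr_wpDl.
by move: (normr_ge0 ((x : R) - y)); move: `|_ - _| => d; nra.
Unshelve. all: by end_near. Qed.

(** Gronwall for the squared distance in phase space; the cross terms are
    absorbed by [2 a b <= a ^ 2 + b ^ 2]. *)
Lemma newton_stable T y1 z1 y2 z2 t : newton g T y1 z1 -> newton g T y2 z2 ->
  0 <= t <= T -> (y1 t - y2 t) ^+ 2 + (z1 t - z2 t) ^+ 2 <=
  ((y1 0 - y2 0) ^+ 2 + (z1 0 - z2 0) ^+ 2) * expR ((1 + L) * t).
Proof.
move=> h1 h2 /andP[t0 tT].
apply: (@gronwall (fun t => (y1 t - y2 t) ^+ 2 + (z1 t - z2 t) ^+ 2)
  (fun t => 2 * (y1 t - y2 t) * (z1 t - z2 t) +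
            2 * (z1 t - z2 t) * (g (y1 t) - g (y2 t)))) => // x /andP[x0 xt].
  have xT : 0 <= x <= T by rewrite x0 (le_trans xt).
  have [dy1 dz1] := h1 x xT; have [dy2 dz2] := h2 x xT.
  by apply: is_deriveDf; apply: is_derive_sqr; apply: is_deriveBf.
set a := y1 x - y2 x; set b := z1 x - z2 x.
have ab : 2 * a * b <= a ^+ 2 + b ^+ 2 by have := sqr_ge0 (a - b); nra.
have : `|b * (g (y1 x) - g (y2 x))| <= `|b| * (L * `|a|).
  by rewrite normrM ler_wpM2l ?gL.
have := ler_norm (b * (g (y1 x) - g (y2 x))).
have nab : 2 * (`|a| * `|b|) <= a ^+ 2 + b ^+ 2.
  rewrite -(real_normK (num_real a)) -(real_normK (num_real b)).
  have := sqr_ge0 (`|a| - `|b|); nra.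
have := ler_wpM2l L0 nab.
set N := `|a|; set M := `|b|; set G := g _ - g _.
move: (a ^+ 2) (b ^+ 2) ab => A B ab; clear -ab => h1 h2 h3.
have : 2 * a * b + 2 * (b * G) <= (A + B) + L * (A + B) by nra.
by rewrite (mulrA 2 b G) (mulrDl 1 L) mul1r; exact: id.
Qed.

Lemma newton_unique T y1 z1 y2 z2 t : newton g T y1 z1 -> newton g T y2 z2 ->
  y1 0 = y2 0 -> z1 0 = z2 0 -> 0 <= t <= T -> y1 t = y2 t /\ z1 t = z2 t.
Proof.
move=> h1 h2 ey ez tT; have := newton_stable h1 h2 tT.
rewrite ey ez !subrr expr0n /= addr0 mul0r => h.
have a0 := sqr_ge0 (y1 t - y2 t); have b0 := sqr_ge0 (z1 t - z2 t).
split; apply/eqP; rewrite -subr_eq0 -sqrf_eq0; apply/eqP; lra.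
Qed.

(** The equation is reversible, so the solutions that leave a point of zero
    velocity in the two directions of time agree by uniqueness. *)
Lemma newton_reflect T y z x : 0 <= T -> newton g (2 * T) y z -> z T = 0 ->
  0 <= x <= 2 * T -> y (2 * T - x) = y x /\ z (2 * T - x) = - z x.
Proof.
move=> T0 h zT.
have dplus (t : R) : is_derive t 1 (fun t : R => T + t) 1.
  have := is_derive_affine 1 T t.
  by rewrite (_ : (fun t : R => 1 * t + T) = (fun t : R => T + t)) //;
    apply/funext => u; rewrite mul1r addrC.
have dminus (t : R) : is_derive t 1 (fun t : R => T - t) (- 1).
  have := is_derive_affine (- 1) T t.
  by rewrite (_ : (fun t : R => - 1 * t + T) = (fun t : R => T - t)) //;
    apply/funext => u; rewrite mulN1r addrC.
have h1 : newton g T (fun t => y (T + t)) (fun t => z (T + t)).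
  move=> t /andP[t0 tT]; have [|dy dz] := h (T + t); first by apply/andP; split; lra.
  split; first by have := @is_derive_compf _ y (fun t => T + t) t _ _ dy (dplus t); rewrite mulr1.
  by have := @is_derive_compf _ z (fun t => T + t) t _ _ dz (dplus t); rewrite mulr1.
have h2 : newton g T (fun t => y (T - t)) (fun t => -1 * z (T - t)).
  move=> t /andP[t0 tT]; have [|dy dz] := h (T - t); first by apply/andP; split; lra.
  split.
    by have := @is_derive_compf _ y (fun t => T - t) t _ _ dy (dminus t); rewrite mulrC.
  have := is_deriveZf (-1) (@is_derive_compf _ z (fun t => T - t) t _ _ dz (dminus t)).
  by rewrite mulrCA mulrNN mulr1 mulr1.
have key t : 0 <= t <= T -> y (T + t) = y (T - t) /\ z (T + t) = - z (T - t).
  move=> tT; have [] := newton_unique h1 h2 _ _ tT; rewrite ?subr0 ?addr0 ?zT ?mulr0 //.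
  by rewrite mulN1r => -> ->.
move=> /andP[x0 xT]; have [xle|xle] := leP x T.
  have [|] := key (T - x); first by apply/andP; split; lra.
  have -> : T + (T - x) = 2 * T - x by ring.
  by have -> : T - (T - x) = x by ring.
have [|] := key (x - T); first by apply/andP; split; lra.
have -> : T + (x - T) = x by ring.
have -> : T - (x - T) = 2 * T - x by ring.
by move=> -> ->; rewrite opprK.
Qed.

Section Picard.
Variables (c s : R).

(** One Picard iteration in integral form.  The solution is sought on [t >= 0]
    only: evaluating the iterate at [Num.max x 0] makes the next one differentiable
    on the whole line, so that no one-sided derivative at 0 is needed. *)
Definition newton_step (y : R -> R) : R -> R :=
  fun t => c + (s * t + prim (prim (fun x : R => g (y (Num.max x 0)))) t).

Definition newton_iter n : R -> R := iter n newton_step (fun=> 0).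

Let newton_force (y : R -> R) (x : R) := g (y (Num.max x 0)).

Lemma continuous_newton_force y : continuous y -> continuous (newton_force y).
Proof.
move=> cy x; apply: (@continuous_comp _ _ _ (fun x : R => y (Num.max x 0))); last first.
  exact: lipschitz_continuous.
apply: (@continuous_comp _ _ _ (fun x : R => Num.max x 0)); last exact: cy.
by apply: continuous_max; [exact: cvg_id|exact: cvg_cst].
Qed.

Lemma newton_stepP (y : R -> R) (x : R) : continuous y ->
  is_derive x 1 (newton_step y) (s + prim (newton_force y) x) /\
  is_derive x 1 (fun x : R => s + prim (newton_force y) x) (newton_force y x).
Proof.
move=> cy; have cf := continuous_newton_force cy; split.
  rewrite /newton_step -[X in is_derive _ _ _ X]add0r.
  apply: is_deriveDf.
  apply: is_deriveDf; last by apply: is_derive_prim; apply: continuous_prim.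
  by rewrite -{2}(mulr1 s); apply: is_deriveZf; exact: is_derive_id.
rewrite -[X in is_derive _ _ _ X]add0r; apply: is_deriveDf.
exact: is_derive_prim.
Qed.

Lemma newton_step0 y : newton_step y 0 = c.
Proof. by rewrite /newton_step prim0; ring. Qed.

Lemma continuous_newton_step y : continuous y -> continuous (newton_step y).
Proof. by move=> cy x; have [/is_derive_continuous] := newton_stepP x cy. Qed.

Let K := 1 + 2 * L.

(** In the norm with weight [exp (- K t)] two integrations gain a factor
    [1 / K ^ 2], hence [L / K ^ 2 <= 1 / 2].  This gives a contraction on the whole
    half-line, without patching short time intervals. *)
Lemma newton_step_contract y1 y2 C t : continuous y1 -> continuous y2 -> 0 <= C ->
  (forall x : R, 0 <= x <= t -> `|y1 x - y2 x| <= C * expR (K * x)) -> 0 <= t ->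
  `|newton_step y1 t - newton_step y2 t| <= C / 2 * expR (K * t).
Proof.
move=> c1 c2 C0 h t0.
have l0 := L0; have K0 : 0 < K by rewrite /K; lra.
have dE r (x : R) : is_derive x 1 (fun x : R => r * expR (K * x)) (r * K * expR (K * x)).
  rewrite -mulrA; apply: is_deriveZf.
  exact: is_derive_expRM.
have hp x : 0 <= x <= t -> `|prim (newton_force y1) x - prim (newton_force y2) x| <=
    L * C / K * expR (K * x).
  move=> /andP[x0 xt].
  have := @derive_norm_le R (fun x => prim (newton_force y1) x - prim (newton_force y2) x)
    (fun x => newton_force y1 x - newton_force y2 x) _ _ 0 x x0 _ (fun x _ => dE (L * C / K) x) _.
  rewrite !prim0 subrr subr0 => hh.
  apply: (@le_drop _ _ (L * C / K * expR (K * 0))).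
    by rewrite mulr_ge0 ?expR_ge0 // divr_ge0 ?mulr_ge0 // ltW.
  apply: hh => u /andP[u0 ux].
    by apply: is_deriveBf; apply: is_derive_prim; apply: continuous_newton_force.
  rewrite divfK ?gt_eqF // /newton_force max_l //; apply: le_trans (gL _ _) _.
  by rewrite -mulrA ler_wpM2l // h // u0 (le_trans ux).
have := @derive_norm_le R (fun x => newton_step y1 x - newton_step y2 x)
  (fun x : R => s + prim (newton_force y1) x - (s + prim (newton_force y2) x)) _ _ 0 t t0 _
   (fun x _ => dE (C / 2) x) _.
rewrite !newton_step0 subrr subr0 => hh.
apply: (@le_drop _ _ (C / 2 * expR (K * 0))).
  by rewrite mulr_ge0 ?expR_ge0 // divr_ge0.
apply: hh => u ut.
  by apply: is_deriveBf; [have [] := newton_stepP u c1|have [] := newton_stepP u c2].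
have -> : s + prim (newton_force y1) u - (s + prim (newton_force y2) u) =
  prim (newton_force y1) u - prim (newton_force y2) u by ring.
apply: le_trans (hp u ut) _; rewrite ler_wpM2r ?expR_ge0 //.
rewrite ler_pdivrMr // /K; nra.
Qed.

Hypothesis g0 : g 0 = 0.

Lemma continuous_newton_iter n : continuous (newton_iter n).
Proof.
elim: n => [|n IH]; first exact: cst_continuous.
exact: continuous_newton_step.
Qed.

Lemma newton_iter_dist n (t : R) : 0 <= t ->
  `|newton_iter n.+1 t - newton_iter n t| <= (`|c| + `|s|) / 2 ^+ n * expR (K * t).
Proof.
have cs0 : 0 <= `|c| + `|s| by rewrite addr_ge0.
elim: n t => [|n IH] t t0.
  have l0 := L0; rewrite /= expr0 divr1 subr0 /newton_step g0.
  have prim00 x : prim (fun=> 0 : R) x = 0.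
    rewrite -[RHS](prim0 (fun=> 0 : R)); apply: is_derive_0_is_cst => y.
    by apply: is_derive_prim; exact: cst_continuous.
  rewrite (_ : prim (fun=> 0 : R) = fun=> 0); last exact/funext.
  rewrite prim00 addr0.
  have Kt : t <= K * t by rewrite /K; nra.
  have := expR_ge1Dx (K * t).
  have := ler_normD c (s * t); rewrite normrM (ger0_norm t0).
  have := normr_ge0 c; have := normr_ge0 s; nra.
have -> : (`|c| + `|s|) / 2 ^+ n.+1 = (`|c| + `|s|) / 2 ^+ n / 2.
  by rewrite exprS; field; rewrite expf_neq0.
have c1 := @continuous_newton_iter n.+1; have c0 := @continuous_newton_iter n.
apply: newton_step_contract; [exact: c1|exact: c0|by rewrite divr_ge0|by move=> x /andP[x0 _]; exact: IH|by []].
Qed.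

(** The iterates converge geometrically to a continuous [y], locally uniformly;
    one more iteration applied to [y] is twice differentiable and equals [y] for
    nonnegative times. *)
Lemma newton_exists : exists y z : R -> R,
  [/\ y 0 = c, z 0 = s & forall T, newton g T y z].
Proof.
pose C (t : R) := (`|c| + `|s|) * expR (K * t).
have /choice[y0 hy0] : forall t : R, exists l, forall n,
    `|l - newton_iter n (Num.max t 0)| <= 2 * C (Num.max t 0) / 2 ^+ n.
  move=> t; apply: geometric_limit => n.
  apply: le_trans (newton_iter_dist n _) _; first by rewrite le_max lexx orbT.
  by rewrite /C mulrAC.
pose y (t : R) := y0 t.
have l0 := L0; have K0 : 0 < K by rewrite /K; lra.
have cs0 : 0 <= `|c| + `|s| by rewrite addr_ge0.
have hy n (t : R) : 0 <= t -> `|y t - newton_iter n t| <= 2 * C t / 2 ^+ n.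
  by move=> t0; have := hy0 t n; rewrite max_l.
have cy : continuous y.
  move=> t; apply/cvgrPdist_lt => e e0.
  pose M := C (`|t| + 1).
  have [n hn] : exists n, 2 * M / 2 ^+ n < e / 3.
    by apply: half_expn_lt; rewrite divr_gt0.
  have CM x : `|t - x| < 1 -> C (Num.max x 0) <= M.
    move=> tx; rewrite /C /M ler_wpM2l // ler_expR ler_wpM2l ?(ltW K0) //.
    rewrite ge_max addr_ge0 // andbT; rewrite distrC in tx.
    by have := ler_norm (x - t); have := ler_norm t; lra.
  have hM x : `|t - x| < 1 -> `|y x - newton_iter n (Num.max x 0)| < e / 3.
    move=> tx; apply: le_lt_trans (hy0 x n) _; apply: le_lt_trans hn.
    by rewrite ler_pM2r ?invr_gt0 ?exprn_gt0 // ler_pM2l // CM.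
  have cn : continuous (fun x : R => newton_iter n (Num.max x 0)).
    move=> x; apply: (@continuous_comp _ _ _ (fun x : R => Num.max x 0)).
      by apply: continuous_max; [exact: cvg_id|exact: cvg_cst].
    exact: continuous_newton_iter.
  near=> x.
  have tx : `|t - x| < 1 by near: x; apply: near_dist_lt; rewrite ltr01.
  have tt : `|t - t| < 1 by rewrite subrr normr0 ltr01.
  have := hM x tx; have := hM t tt.
  have : `|newton_iter n (Num.max t 0) - newton_iter n (Num.max x 0)| < e / 3.
    near: x; apply: (@cvgr_dist_lt _ _ _ _ _ _ _ (cn t)); by rewrite divr_gt0.
  rewrite !ltr_norml => /andP[? ?] /andP[? ?] /andP[? ?]; apply/andP; split; lra.
have wy (t : R) : 0 <= t -> newton_step y t = y t.
  move=> t0; apply/eqP; rewrite -subr_eq0; apply/eqP.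
  apply: (@half_expn_eq0 _ (2 * C t)) => n.
  have h1 := hy n.+1 t t0.
  have h2 : `|newton_step y t - newton_step (newton_iter n) t| <=
      2 * (`|c| + `|s|) / 2 ^+ n / 2 * expR (K * t).
    apply: newton_step_contract; [exact: cy|exact: continuous_newton_iter| | |by []].
      by rewrite divr_ge0 ?mulr_ge0.
    by move=> x /andP[x0 _]; have := hy n x x0; rewrite /C mulrA mulrAC.
  have := ler_distD (newton_iter n.+1 t) (newton_step y t) (y t).
  move: h1 h2; rewrite /= [`|y t - _|]distrC exprS invfM.
  have -> : 2 * (`|c| + `|s|) / 2 ^+ n / 2 * expR (K * t) =
    C t / 2 ^+ n by rewrite /C; field; rewrite expf_neq0.
  have -> : 2 * C t * (2^-1 / 2 ^+ n) = C t / 2 ^+ n by field; rewrite expf_neq0.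
  have -> : 2 * C t / 2 ^+ n = C t / 2 ^+ n + C t / 2 ^+ n by ring.
  by move=> h1 h2 h3; apply: le_trans h3 (lerD h2 h1).
exists (newton_step y), (fun x => s + prim (newton_force y) x); split.
- exact: newton_step0.
- by rewrite prim0 addr0.
move=> T t /andP[t0 _]; have [d1 d2] := newton_stepP t cy; split => //.
by rewrite wy //; move: d2; rewrite /newton_force max_l.
Unshelve. all: by end_near. Qed.

End Picard.
End Lipschitz.
End Newton.

(** * The Poincare-Miranda theorem in the plane *)

Section SpernerGrid.

(** Oriented crossings between the labels [Some true] and [Some false]; the sign is
    what makes the contributions of the interior edges of the grid cancel. *)
Definition door (x y : option bool) : int :=
  match x, y with
  | Some true, Some false => 1
  | Some false, Some true => - 1
  | _, _ => 0
  end.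

Definition in_square (lab : nat -> nat -> option bool) i j k :=
  [|| lab i j == k, lab i.+1 j == k, lab i j.+1 == k | lab i.+1 j.+1 == k].

(** A triangle that misses one of the three labels has circulation zero, and a
    square is made of two triangles; with few labels this is a finite check. *)
Lemma square_circulation (lab : nat -> nat -> option bool) i j :
  (exists k, ~~ in_square lab i j k) ->
  door (lab i j) (lab i.+1 j) + door (lab i.+1 j) (lab i.+1 j.+1) =
  door (lab i j) (lab i j.+1) + door (lab i j.+1) (lab i.+1 j.+1).
Proof.
rewrite /in_square.
case: (lab i j) => [[]|]; case: (lab i.+1 j) => [[]|];
  case: (lab i j.+1) => [[]|]; case: (lab i.+1 j.+1) => [[]|] //=;
  by case=> -[[]|].
Qed.

(** If every square misses a label, all circulations vanish, so the sum of the
    doors along a column differs from that along the previous column by the door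
    on the top side.  The sum is 0 on the first and on the last column, but the
    top side leads from [Some false] to [Some true], which counts -1. *)
Lemma sperner_grid n (lab : nat -> nat -> option bool) :
  (forall i, (i <= n)%N -> lab i 0%N = None) ->
  (forall i, (i <= n)%N -> lab i n <> None) ->
  (forall j, (j <= n)%N -> lab 0%N j <> Some true) ->
  (forall j, (j <= n)%N -> lab n j <> Some false) ->
  exists i j, [/\ (i < n)%N, (j < n)%N & forall k, in_square lab i j k].
Proof.
move=> hS hN hW hE; apply: contrapT => no.
have sq i j : (i < n)%N -> (j < n)%N ->
    door (lab i j) (lab i.+1 j) + door (lab i.+1 j) (lab i.+1 j.+1) =
    door (lab i j) (lab i j.+1) + door (lab i j.+1) (lab i.+1 j.+1).
  move=> iN jn; apply: square_circulation; apply: contrapT => h; apply: no.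
  by exists i, j; split=> // k; apply/negPn/negP => hk; apply: h; exists k.
pose col i m := \sum_(j < m) door (lab i j) (lab i j.+1).
have colS i m : (i < n)%N -> (m <= n)%N ->
    col i.+1 m = col i m + door (lab i m) (lab i.+1 m).
  move=> iN; elim: m => [|m IH] mn.
    by rewrite /col !big_ord0 hS ?(ltnW iN) // hS.
  rewrite /col !big_ord_recr /= -/(col _ _) -/(col _ _) IH ?(ltnW mn) //.
  by rewrite -addrA sq // addrA.
have chi i : (i <= n)%N -> col i n = - (lab i n == Some true)%:Z.
  elim: i => [_|i IH iN].
    rewrite /col big1 => [|j _].
      by case: (lab 0%N n) (hW n (leqnn n)) => [[]|].
    move: (hW j (ltnW (ltn_ord j))) (hW j.+1 (ltn_ord j)).
    by case: (lab 0%N j) => [[]|] //; case: (lab 0%N j.+1) => [[]|].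
  rewrite colS // IH ?(ltnW iN) //.
  move: (hN i (ltnW iN)) (hN i.+1 iN).
  by case: (lab i n) => [[]|] //; case: (lab i.+1 n) => [[]|].
have : col n n = 0.
  rewrite /col big1 // => j _.
  move: (hE j (ltnW (ltn_ord j))) (hE j.+1 (ltn_ord j)).
  by case: (lab n j) => [[]|] //; case: (lab n j.+1) => [[]|].
rewrite chi //; move: (hE n (leqnn n)) (hN n (leqnn n)).
by case: (lab n n) => [[]|].
Qed.

End SpernerGrid.

Section PoincareMiranda.
Context {R : realType}.
Variables (f g : R * R -> R) (a b c d : R).
Hypotheses (ab : a < b) (cd : c < d).

Let rect (q : R * R) := a <= q.1 <= b /\ c <= q.2 <= d.

Hypothesis cf : forall q, rect q -> {for q, continuous f}.
Hypothesis cg : forall q, rect q -> {for q, continuous g}.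
Hypothesis g_left : forall y, c <= y <= d -> g (a, y) <= 0.
Hypothesis g_right : forall y, c <= y <= d -> 0 <= g (b, y).
Hypothesis f_bot : forall x, a <= x <= b -> 0 <= f (x, c).
Hypothesis f_top : forall x, a <= x <= b -> f (x, d) <= 0.

(** Label a grid point by the signs of [f] and [g]: [None] for [0 <= f], and
    [Some true], [Some false] for [f <= 0] with [0 <= g], [g <= 0].  Where a
    function vanishes the label is free, and it is chosen so as to satisfy the
    boundary conditions of Sperner's lemma. *)
Lemma sign_cell (e : R) : 0 < e -> exists2 q, rect q &
  [/\ exists2 r, ball q e r & 0 <= f r,
      exists2 r, ball q e r & f r <= 0 /\ 0 <= g r &
      exists2 r, ball q e r & f r <= 0 /\ g r <= 0].
Proof.
move=> e0; set l := (b - a) + (d - c).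
have ab' := ab; have cd' := cd; have l0 : 0 < l by rewrite /l; lra.
have [n n1 ln] : exists2 n : nat, (0 < n)%N & l / n%:R < e.
  exists (Num.truncn (l / e)).+1 => //.
  by rewrite ltr_pdivrMr ?ltr0n // mulrC -ltr_pdivrMr //; exact: truncnS_gt.
have n0 : 0 < n%:R :> R by rewrite ltr0n.
pose X (i : nat) : R := a + (b - a) * (i%:R / n%:R).
pose Y (j : nat) : R := c + (d - c) * (j%:R / n%:R).
have frac i : (i <= n)%N -> 0 <= (i%:R / n%:R : R) <= 1.
  move=> iN; apply/andP; split; first by rewrite divr_ge0 ?ler0n.
  by rewrite ler_pdivrMr ?mul1r ?ler_nat //.
have rXY i j : (i <= n)%N -> (j <= n)%N -> rect (X i, Y j).
  by move=> /frac hi /frac hj; rewrite /rect /X /Y /=; split; nra.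
have X0 : X 0%N = a by rewrite /X mul0r mulr0 addr0.
have Y0 : Y 0%N = c by rewrite /Y mul0r mulr0 addr0.
have Xn : X n = b by rewrite /X divff ?gt_eqF // mulr1; ring.
have Yn : Y n = d by rewrite /Y divff ?gt_eqF // mulr1; ring.
pose lab (i j : nat) : option bool :=
  if (j == 0%N) then None else if (j != n) && (0 < f (X i, Y j)) then None
  else if i == 0%N then Some false else if (i == n) || (0 < g (X i, Y j)) then Some true
  else Some false.
have [i [j [iN jn ij]]] : exists i j,
    [/\ (i < n)%N, (j < n)%N & forall k, in_square lab i j k].
  apply: sperner_grid => [i _|i _|j _|j _]; rewrite /lab ?eqxx //= ?(gtn_eqF n1);
    by do 3?[case: ifP => //].
have labP i' j' : (i' <= n)%N -> (j' <= n)%N ->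
   match lab i' j' with
   | None => 0 <= f (X i', Y j')
   | Some true => f (X i', Y j') <= 0 /\ 0 <= g (X i', Y j')
   | Some false => f (X i', Y j') <= 0 /\ g (X i', Y j') <= 0
   end.
  move=> iN' jn'; have [hx hy] := rXY _ _ iN' jn'; rewrite /lab.
  case: (j' =P 0%N) => [->|_]; first by rewrite Y0; exact: f_bot.
  have fpos : (j' != n) && (0 < f (X i', Y j')) = false -> f (X i', Y j') <= 0.
    case: (j' =P n) => [->|_] /=; first by rewrite Yn => _; exact: f_top.
    by move=> /negbT; rewrite -leNgt.
  case: ifP => [/andP[_ /ltW] //|/fpos {}fpos].
  case: (i' =P 0%N) => [i0|_].
    by rewrite i0 X0 in hx fpos *; split; [exact: fpos|exact: g_left].
  case: (i' =P n) => [i0|_] /=.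
    by rewrite i0 Xn in fpos *; split; [exact: fpos|exact: g_right].
  by case: ltP => [/ltW|]; split.
exists (X i, Y j); first by apply: rXY; exact: ltnW.
have hb i' j' : (i <= i' <= i.+1)%N -> (j <= j' <= j.+1)%N ->
    ball (X i, Y j) e (X i', Y j').
  have gen (u v : R) (k k' : nat) : u < v -> v - u <= l -> (k <= k' <= k.+1)%N ->
     `|(u + (v - u) * (k%:R / n%:R)) - (u + (v - u) * (k'%:R / n%:R))| < e.
    move=> uv vl /andP[k1 k2]; apply: le_lt_trans ln.
    have -> : u + (v - u) * (k%:R / n%:R) - (u + (v - u) * (k'%:R / n%:R)) =
      - ((v - u) * (k' - k)%:R / n%:R) by rewrite natrB //; ring.
    rewrite normrN ger0_norm ?divr_ge0 ?mulr_ge0 ?subr_ge0 ?(ltW uv) //.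
    rewrite ler_pM2r ?invr_gt0 //; apply: le_trans vl.
    rewrite -[leRHS]mulr1 ler_wpM2l ?subr_ge0 ?(ltW uv) //.
    by rewrite lern1 leq_subLR addn1.
  by move=> hi hj; split; apply: gen => //; rewrite /l; lra.
have cell k : exists2 ij, (ij.1 <= n)%N /\ (ij.2 <= n)%N &
    ball (X i, Y j) e (X ij.1, Y ij.2) /\ lab ij.1 ij.2 = k.
  have /or4P[] := ij k => /eqP E; [exists (i, j)|exists (i.+1, j)|exists (i, j.+1)|exists (i.+1, j.+1)];
    split; rewrite ?(ltnW iN) ?(ltnW jn) //; apply: hb => /=;
    by rewrite ?leqnn ?leqnSn.
split.
- have [[i' j'] [h1 h2] [h3 h4]] := cell None.
  by exists (X i', Y j') => //; have := labP _ _ h1 h2; rewrite h4.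
- have [[i' j'] [h1 h2] [h3 h4]] := cell (Some true).
  by exists (X i', Y j') => //; have := labP _ _ h1 h2; rewrite h4.
- have [[i' j'] [h1 h2] [h3 h4]] := cell (Some false).
  by exists (X i', Y j') => //; have := labP _ _ h1 h2; rewrite h4.
Qed.

(** Smaller and smaller cells of the previous lemma accumulate at a point of the
    rectangle, where continuity forces both signs of both functions. *)
Lemma poincare_miranda : exists q, [/\ rect q, f q = 0 & g q = 0].
Proof.
have /choice[q hq] : forall n : nat, exists q, rect q /\
  [/\ exists2 r, ball q (1 / 2 ^+ n : R) r & 0 <= f r,
      exists2 r, ball q (1 / 2 ^+ n : R) r & f r <= 0 /\ 0 <= g r &
      exists2 r, ball q (1 / 2 ^+ n : R) r & f r <= 0 /\ g r <= 0].
  move=> n; have [|q h1 h2] := @sign_cell (1 / 2 ^+ n); first by rewrite divr_gt0.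
  by exists q.
(* A cluster point of the cells, the sides of which tend to 0. *)
have K : compact (`[a, b] `*` `[c, d] : set (R * R)).
  by apply: compact_setX; exact: segment_compact.
have [z [zK clz]] : (`[a, b] `*` `[c, d] : set (R * R)) `&` cluster (q @ \oo) !=set0.
  apply: K; exists 0%N => // n _ /=; have [[h1 h2] _] := hq n.
  by rewrite !in_itv /=.
have rz : rect z by move: zK => [] /=; rewrite !in_itv.
exists z.
have near_z (e : R) : 0 < e -> exists n, forall r, ball (q n) (1 / 2 ^+ n : R) r -> ball z e r.
  move=> e0; have e2 : 0 < e / 2 by rewrite divr_gt0.
  have [N hN] := half_expn_lt 1 e2.
  have [_ [[n /= Nn <-] hn]] := clz (q @` [set n | (N <= n)%N]) _
     (ex_intro2 _ _ N I (fun n h => ex_intro2 _ _ n h erefl)) (nbhsx_ballx z (e / 2) e2).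
  exists n => r hr; rewrite [e]splitr; apply: ball_triangle hn _.
  apply: le_ball hr; apply/ltW/(le_lt_trans _ hN).
  by rewrite ler_pM2l // lef_pV2 ?posrE ?exprn_gt0 // ler_eXn2l ?ltr1n.
have pos (h : R * R -> R) : {for z, continuous h} ->
   (forall n, exists2 r, ball (q n) (1 / 2 ^+ n : R) r & 0 <= h r) -> 0 <= h z.
  move=> ch hp; rewrite leNgt; apply/negP => hz.
  have [e /= e0 he] : exists2 e : R, 0 < e & ball z e `<=` [set r | h r < 0].
    have : \forall r \near z, h r < 0 by apply: (cvgr_lt _ ch).
    by move=> /nbhs_ballP.
  have [n hn] := near_z e e0; have [r r1 r2] := hp n.
  by have := he r (hn r r1); rewrite /= ltNge r2.
have neg (h : R * R -> R) : {for z, continuous h} ->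
   (forall n, exists2 r, ball (q n) (1 / 2 ^+ n : R) r & h r <= 0) -> h z <= 0.
  move=> ch hp; rewrite -oppr_ge0; apply: (pos (fun r => - h r)).
    exact: continuousN.
  by move=> n; have [r r1 r2] := hp n; exists r; rewrite ?oppr_ge0.
split => //; apply/le_anti/andP; split.
- by apply: neg; [exact: cf|move=> n; have [_ [_ [r h1 [h2 h3]] _]] := hq n; exists r].
- by apply: pos; [exact: cf|move=> n; have [_ [[r h1 h2] _ _]] := hq n; exists r].
- by apply: neg; [exact: cg|move=> n; have [_ [_ _ [r h1 [h2 h3]]]] := hq n; exists r].
- by apply: pos; [exact: cg|move=> n; have [_ [_ [r h1 [h2 h3]] _]] := hq n; exists r].
Qed.

End PoincareMiranda.

(** * Dependence on the initial data *)

Section Flow.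
Context {R : realType}.
Variables (g : R -> R) (L : R).
Hypothesis L0 : 0 <= L.
Hypothesis gL : forall u v, `|g u - g v| <= L * `|u - v|.
Hypothesis g0 : g 0 = 0.

(** Solutions are chosen once and for all as functions of the initial data. *)
Definition newton_flow (c s : R) : {yz : (R -> R) * (R -> R) |
  [/\ yz.1 0 = c, yz.2 0 = s & forall T, newton g T yz.1 yz.2]}.
Proof.
apply: cid; have [y [z h]] := newton_exists L0 gL c s g0.
by exists (y, z).
Qed.

Definition position c s : R -> R := (sval (newton_flow c s)).1.
Definition velocity c s : R -> R := (sval (newton_flow c s)).2.

Lemma position0 c s : position c s 0 = c.
Proof. by rewrite /position; case: (newton_flow c s) => ? []. Qed.

Lemma velocity0 c s : velocity c s 0 = s.
Proof. by rewrite /velocity; case: (newton_flow c s) => ? []. Qed.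

Lemma newton_position c s T : newton g T (position c s) (velocity c s).
Proof. by rewrite /position /velocity; case: (newton_flow c s) => ? []. Qed.

Lemma is_derive_position c s (t : R) : 0 <= t -> is_derive t 1 (position c s) (velocity c s t).
Proof. by move=> t0; have [|] := @newton_position c s t t; rewrite ?t0 ?lexx. Qed.

Lemma is_derive_velocity c s (t : R) : 0 <= t -> is_derive t 1 (velocity c s) (g (position c s t)).
Proof. by move=> t0; have [|] := @newton_position c s t t; rewrite ?t0 ?lexx. Qed.

(** The square of the L2 norm of the solution on [[0, t]]. *)
Definition sqmass c s : R -> R := prim (fun t => position c s (Num.max t 0) ^+ 2).

Lemma sqmass0 c s : sqmass c s 0 = 0. Proof. exact: prim0. Qed.

Lemma is_derive_sqmass c s (t : R) : 0 <= t ->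
  is_derive t 1 (sqmass c s) (position c s t ^+ 2).
Proof.
move=> t0; rewrite -{2}(max_l t0); apply: is_derive_prim => x.
apply: (@continuous_comp _ _ _ (fun x : R => position c s (Num.max x 0)) (fun y : R => y ^+ 2)); last first.
  exact: exprn_continuous.
apply: (@continuous_comp _ _ _ (fun x : R => Num.max x 0) (position c s)).
  by apply: continuous_max; [exact: cvg_id|exact: cvg_cst].
apply: is_derive_continuous; apply: is_derive_position.
by rewrite le_max lexx orbT.
Qed.

Lemma sqmass_nondec c s t1 t2 : 0 <= t1 -> t1 <= t2 -> sqmass c s t1 <= sqmass c s t2.
Proof.
move=> t0 t12; apply: (@derive_ge0_le R _ (fun t => position c s t ^+ 2)) => // x /andP[x1 _].
  by apply: is_derive_sqmass; apply: le_trans x1.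
exact: sqr_ge0.
Qed.

Section FlowOfParameters.
Variables (T : topologicalType) (C S : T -> R) (q0 : T).
Hypotheses (cC : {for q0, continuous C}) (cS : {for q0, continuous S}).

Lemma flow_near t1 e : 0 < e -> \forall q \near q0, forall t, 0 <= t <= t1 ->
  `|position (C q) (S q) t - position (C q0) (S q0) t| < e /\
  `|velocity (C q) (S q) t - velocity (C q0) (S q0) t| < e.
Proof.
move=> e0; pose E := expR ((1 + L) * t1).
have E0 : 0 < E by exact: expR_gt0.
(* The squared distance of the data is at most 2 d, and Gronwall multiplies it
   by at most E. *)
pose d := Num.min 1 (e ^+ 2 / (4 * E)).
have d0 : 0 < d by rewrite lt_min ltr01 divr_gt0 ?exprn_gt0 ?mulr_gt0.
have d1 : d <= 1 by rewrite ge_min lexx.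
have de : d <= e ^+ 2 / (4 * E) by rewrite ge_min lexx orbT.
near=> q => t /andP[t0 tt1].
have hC : `|C q0 - C q| < d by near: q; exact: (@cvgr_dist_lt _ _ _ _ _ _ _ cC d d0).
have hS : `|S q0 - S q| < d by near: q; exact: (@cvgr_dist_lt _ _ _ _ _ _ _ cS d d0).
have tt : 0 <= t <= t1 by rewrite t0.
have := newton_stable L0 gL (@newton_position (C q) (S q) t1) (@newton_position (C q0) (S q0) t1) tt.
rewrite !position0 !velocity0.
have hE : expR ((1 + L) * t) <= E.
  by rewrite ler_expR ler_wpM2l // addr_ge0.
have small : (C q - C q0) ^+ 2 + (S q - S q0) ^+ 2 <= 2 * d.
  rewrite -(real_normK (num_real (C q - _))) -(real_normK (num_real (S q - _))).
  rewrite (distrC (C q)) (distrC (S q)).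
  move: hC hS (normr_ge0 (C q0 - C q)) (normr_ge0 (S q0 - S q)).
  move: `|C q0 - C q| `|S q0 - S q| => a b *; nra.
move: small; set D0 := _ + _ => small.
have D00 : 0 <= D0 by rewrite addr_ge0 ?sqr_ge0.
set a := position _ _ t - _; set b := velocity _ _ t - _ => hab.
have {}hab : a ^+ 2 + b ^+ 2 < e ^+ 2.
  apply: le_lt_trans hab _.
  have h1 : D0 * expR ((1 + L) * t) <= 2 * d * E.
    by apply: ler_pM => //; rewrite ltW ?expR_gt0.
  move: de; rewrite ler_pdivlMr ?mulr_gt0 // => de.
  by have := mulr_gt0 d0 E0; lra.
split; rewrite -ltr_sqr ?nnegrE ?(ltW e0) ?normr_ge0 // real_normK ?num_real //.
  by have := sqr_ge0 b; lra.
by have := sqr_ge0 a; lra.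
Unshelve. all: by end_near. Qed.

Lemma sqmass_near t1 e : 0 < e -> \forall q \near q0, forall t, 0 <= t <= t1 ->
  `|sqmass (C q) (S q) t - sqmass (C q0) (S q0) t| < e.
Proof.
move=> e0; have [t10|t10] := ltP t1 0.
  by near=> q => t /andP[t0 tt]; have := lt_le_trans t10 (le_trans t0 tt); rewrite ltxx.
have [x0 x01 hx0] : exists2 x0, x0 \in `[0, t1]%R &
    forall t, t \in `[0, t1]%R -> position (C q0) (S q0) t ^+ 2 <= position (C q0) (S q0) x0 ^+ 2.
  apply: EVT_max => //.
  apply: (@is_derive_within R _ (fun x => 2 * position (C q0) (S q0) x * velocity (C q0) (S q0) x)) => x /andP[x0 _].
  by apply: is_derive_sqr; exact: is_derive_position.
pose N := `|position (C q0) (S q0) x0|.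
pose r := 2 * (1 + 2 * N) * (t1 + 1).
have N0 : 0 <= N by exact: normr_ge0.
have r0 : 0 < r by rewrite /r; apply: mulr_gt0; [apply: mulr_gt0|]; lra.
pose d := Num.min 1 (e / r).
have d0 : 0 < d by rewrite lt_min ltr01 divr_gt0.
have d1 : d <= 1 by rewrite ge_min lexx.
have de : d <= e / r by rewrite ge_min lexx orbT.
near=> q => t /andP[t0 tt1].
have hq : forall t, 0 <= t <= t1 ->
  `|position (C q) (S q) t - position (C q0) (S q0) t| < d /\
  `|velocity (C q) (S q) t - velocity (C q0) (S q0) t| < d.
  by near: q; exact: flow_near.
have := @derive_norm_le R (fun t => sqmass (C q) (S q) t - sqmass (C q0) (S q0) t)
  (fun t => position (C q) (S q) t ^+ 2 - position (C q0) (S q0) t ^+ 2)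
  (fun t => (d * (1 + 2 * N)) * t) (fun=> d * (1 + 2 * N)) 0 t t0.
rewrite !sqmass0 subrr subr0 mulr0 subr0 => h.
apply: (@le_lt_trans _ _ (d * (1 + 2 * N) * t)).
  apply: h => x /andP[x0' xt].
  - by apply: is_deriveBf; exact: is_derive_sqmass.
  - exact: is_derive_linear.
  have xx : 0 <= x <= t1 by rewrite x0' (le_trans xt).
  have [h1 _] := hq x xx.
  have h2 : `|position (C q0) (S q0) x| <= N.
    rewrite -ler_sqr ?nnegrE // !real_normK ?num_real //.
    by apply: hx0; rewrite in_itv.
  rewrite subr_sqr normrM.
  have h3 : `|position (C q) (S q) x + position (C q0) (S q0) x| <= 1 + 2 * N.
    have -> : position (C q) (S q) x + position (C q0) (S q0) x =
      (position (C q) (S q) x - position (C q0) (S q0) x) + 2 * position (C q0) (S q0) x by ring.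
    apply: le_trans (ler_normD _ _) _; rewrite normrM normr_nat; lra.
  by apply: ler_pM => //; exact: ltW.
move: de; rewrite ler_pdivlMr // /r => de.
have : d * (1 + 2 * N) * t <= d * (1 + 2 * N) * t1.
  by rewrite ler_wpM2l // mulr_ge0 ?(ltW d0) //; lra.
have : 0 < d * (1 + 2 * N) by rewrite mulr_gt0 //; lra.
move: de; rewrite (_ : d * (2 * (1 + 2 * N) * (t1 + 1)) = 2 * ((d * (1 + 2 * N)) * (t1 + 1))); last by ring.
move: (d * (1 + 2 * N)) => K; nra.
Unshelve. all: by end_near. Qed.

(** Evaluation at a time that itself depends continuously on the parameter. *)
Lemma continuous_at_time (F : T -> R -> R) (tau : T -> R) :
  (forall t1 e, 0 < e -> \forall q \near q0, forall t, 0 <= t <= t1 ->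
     `|F q t - F q0 t| < e) ->
  {for tau q0, continuous (F q0)} -> {for q0, continuous tau} -> 0 < tau q0 ->
  {for q0, continuous (fun q => F q (tau q))}.
Proof.
move=> hF cF ctau tau0; apply/cvgrPdist_lt => e e0; have e2 : 0 < e / 2 by rewrite divr_gt0.
near=> q.
have h1 : `|F q0 (tau q0) - F q0 (tau q)| < e / 2.
  near: q; exact: (@cvgr_dist_lt _ _ _ _ _ _ _ (continuous_comp ctau cF) _ e2).
have h2 : `|tau q0 - tau q| < tau q0.
  by near: q; exact: (@cvgr_dist_lt _ _ _ _ _ _ _ ctau _ tau0).
have h3 : forall t, 0 <= t <= 2 * tau q0 -> `|F q t - F q0 t| < e / 2.
  by near: q; exact: hF.
have := h3 (tau q); move: h2; rewrite ltr_distl => /andP[h4 h5] h6.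
have {}h6 : `|F q (tau q) - F q0 (tau q)| < e / 2.
  by apply: h6; apply/andP; split; lra.
have := ler_distD (F q0 (tau q)) (F q0 (tau q0)) (F q (tau q)).
by rewrite (distrC (F q0 (tau q)) (F q _)); lra.
Unshelve. all: by end_near. Qed.

End FlowOfParameters.
End Flow.

(** * The soliton *)

Section Soliton.
Context {R : realType}.
Variable k : R.
Hypothesis k0 : 0 < k.

Definition ch (x : R) : R := (expR (k * x) + expR (- k * x)) / 2.
Definition sh (x : R) : R := (expR (k * x) - expR (- k * x)) / 2.
Definition th (x : R) : R := sh x / ch x.
(** The function [(1 + k) ^ (1 / (2 k)) * cosh (k x) ^ (- 1 / k)], written with
    exponential and logarithm so that its derivatives and powers are immediate. *)
Definition soliton (x : R) : R := expR (ln (1 + k) / (2 * k) - ln (ch x) / k).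
Definition dsoliton (x : R) : R := - (soliton x * th x).

Lemma ch_gt0 x : 0 < ch x.
Proof. by rewrite /ch divr_gt0 // addr_gt0 ?expR_gt0. Qed.

Lemma is_derive_ch (x : R) : is_derive x 1 ch (k * sh x).
Proof.
have h := is_deriveZf (2^-1) (is_deriveDf (is_derive_expRM k x) (is_derive_expRM (- k) x)).
rewrite (_ : ch = fun y : R => 2^-1 * (expR (k * y) + expR (- k * y))); last first.
  by apply/funext => y; rewrite mulrC.
by apply: (is_derive_eq h); rewrite /sh; ring.
Qed.

Lemma is_derive_sh (x : R) : is_derive x 1 sh (k * ch x).
Proof.
have h := is_deriveZf (2^-1) (is_deriveBf (is_derive_expRM k x) (is_derive_expRM (- k) x)).
rewrite (_ : sh = fun y : R => 2^-1 * (expR (k * y) - expR (- k * y))); last first.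
  by apply/funext => y; rewrite mulrC.
by apply: (is_derive_eq h); rewrite /ch; ring.
Qed.

Lemma ch2Bsh2 x : ch x ^+ 2 - sh x ^+ 2 = 1.
Proof.
by rewrite -[RHS](expRxMexpNx_1 (k * x)) /ch /sh !mulNr; field.
Qed.

Lemma is_derive_th (x : R) : is_derive x 1 th (k * (1 - th x ^+ 2)).
Proof.
have cx : ch x != 0 by rewrite gt_eqF // ch_gt0.
have hV : is_derive x 1 (fun y : R => (ch y)^-1) (- (ch x) ^- 2 * (k * sh x)).
  exact: (is_deriveV cx (is_derive_ch x)).
have h := is_deriveMf (is_derive_sh x) hV.
apply: (is_derive_eq h); rewrite /th; field; exact: cx.
Qed.

Lemma soliton_gt0 x : 0 < soliton x. Proof. exact: expR_gt0. Qed.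

Lemma is_derive_soliton (x : R) : is_derive x 1 soliton (dsoliton x).
Proof.
have cx := ch_gt0 x.
have hl : is_derive x 1 (fun y : R => ln (ch y)) ((ch x)^-1 * (k * sh x)).
  exact: (is_derive_compf (is_derive1_ln cx) (is_derive_ch x)).
have hb : is_derive x 1 (fun y : R => ln (1 + k) / (2 * k) - k^-1 * ln (ch y))
   (0 - k^-1 * ((ch x)^-1 * (k * sh x))).
  by apply: is_deriveBf; apply: is_deriveZf.
have h := is_derive_compf (is_derive_expR _) hb.
rewrite (_ : soliton = fun y : R => expR (ln (1 + k) / (2 * k) - k^-1 * ln (ch y))); last first.
  by apply/funext => y; rewrite /soliton; congr (expR (_ - _)); rewrite mulrC.
apply: (is_derive_eq h); rewrite /dsoliton /soliton /th [_ / k]mulrC.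
by field; rewrite !gt_eqF // k0.
Qed.

(** Equivalent to [soliton ^ (2 k) = (1 + k) / cosh (k x) ^ 2]; this is what turns the
    second derivative of the soliton into the nonlinear term. *)
Lemma soliton_powR x : soliton x `^ (2 * k) = (1 + k) * (1 - th x ^+ 2).
Proof.
have cx := ch_gt0 x; have k0' := k0.
rewrite /soliton -expRM.
have -> : (ln (1 + k) / (2 * k) - ln (ch x) / k) * (2 * k) = ln (1 + k) - (ln (ch x) + ln (ch x)).
  by field; rewrite gt_eqF.
rewrite expRB expRD !lnK ?posrE //; last lra.
have -> : 1 - th x ^+ 2 = (ch x ^+ 2)^-1.
  have c2 : ch x ^+ 2 != 0 by rewrite expf_neq0 // gt_eqF.
  apply: (mulIf c2); rewrite mulVf // /th expr_div_n mulrBl divfK // mul1r.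
  exact: ch2Bsh2.
by rewrite expr2.
Qed.

Lemma is_derive_dsoliton (x : R) :
  is_derive x 1 dsoliton (soliton x - soliton x `^ (2 * k + 1)).
Proof.
have h := is_deriveZf (-1) (is_deriveMf (is_derive_soliton x) (is_derive_th x)).
rewrite (_ : dsoliton = fun y : R => -1 * (soliton y * th y)); last first.
  by apply/funext => y; rewrite mulN1r.
apply: (is_derive_eq h).
rewrite powRD; last by rewrite (gt_eqF (soliton_gt0 x)) implybT.
rewrite soliton_powR powRr1; last exact/ltW/soliton_gt0.
by rewrite /dsoliton; ring.
Qed.

Definition soliton_max : R := expR (ln (1 + k) / (2 * k)).

Lemma soliton0 : soliton 0 = soliton_max.
Proof.
by rewrite /soliton /ch !mulr0 expR0 divff // ln1 mul0r subr0.
Qed.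

Lemma soliton_max_gt1 : 1 < soliton_max.
Proof.
have k0' := k0.
rewrite /soliton_max expR_gt1 divr_gt0 //; last lra.
by apply: ln_gt0; lra.
Qed.

Lemma dsoliton0 : dsoliton 0 = 0.
Proof. by rewrite /dsoliton /th /sh !mulr0 subrr !mul0r mulr0 oppr0. Qed.

Lemma th_gt0 x : 0 < x -> 0 < th x.
Proof.
move=> x0; rewrite divr_gt0 ?ch_gt0 // divr_gt0 // subr_gt0 ltr_expR.
by rewrite mulNr; have := mulr_gt0 k0 x0; lra.
Qed.

Lemma th_lt1 x : th x < 1.
Proof.
rewrite /th ltr_pdivrMr ?ch_gt0 // mul1r /sh /ch.
by have := expR_gt0 (- k * x); lra.
Qed.

Lemma th_ge0 x : 0 <= x -> 0 <= th x.
Proof.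
rewrite le_eqVlt => /predU1P[<-|/th_gt0/ltW //].
by rewrite /th /sh !mulr0 subrr !mul0r.
Qed.

Lemma dsoliton_lt0 x : 0 < x -> dsoliton x < 0.
Proof. by move=> x0; rewrite /dsoliton oppr_lt0 mulr_gt0 ?soliton_gt0 ?th_gt0. Qed.

Lemma dsoliton_norm x : 0 <= x -> `|dsoliton x| <= soliton x.
Proof.
move=> x0; rewrite /dsoliton normrN normrM (gtr0_norm (soliton_gt0 x)).
rewrite (ger0_norm (th_ge0 x0)) -[leRHS]mulr1 ler_wpM2l ?(ltW (soliton_gt0 x)) //.
exact/ltW/th_lt1.
Qed.

Lemma soliton_le_max x : soliton x <= soliton_max.
Proof.
have k0' := k0.
rewrite /soliton /soliton_max ler_expR lerBlDr lerDl divr_ge0 ?(ltW k0) //.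
apply: ln_ge0; have := ch2Bsh2 x; have := ch_gt0 x; have := sqr_ge0 (sh x); nra.
Qed.

Lemma soliton_decay : exists2 C, 0 < C & forall x, soliton x <= C * expR (- x).
Proof.
have k0' := k0.
exists (expR (ln (1 + k) / (2 * k) + ln 2 / k)); first exact: expR_gt0.
move=> x; rewrite -expRD /soliton ler_expR.
have : k * x - ln 2 <= ln (ch x).
  rewrite -[X in X - _]expRK -ln_div ?posrE ?expR_gt0 // ler_ln ?posrE ?divr_gt0 ?expR_gt0 ?ch_gt0 //.
    by rewrite /ch ler_pM2r ?invr_gt0 // lerDl expR_ge0.
  by rewrite addr_gt0 ?expR_gt0.
have kV : 0 < k^-1 by rewrite invr_gt0.
rewrite -(ler_pM2r kV).
have -> : (k * x - ln 2) / k = x - ln 2 / k by field; rewrite gt_eqF.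
by move: (ln _ / _) (ln _ / _) (ln _ / _) => a b c; lra.
Qed.

End Soliton.

(** * The truncated nonlinearity and its potential *)

Section TruncatedForce.
Context {R : realType}.
Variables p B : R.
Hypotheses (p2 : 2 < p) (B1 : 1 <= B).

Definition clamp (u : R) : R := Num.max 0 (Num.min u B).
(** For [u] in [[0, B]] this is [u - u ^ (p - 1)]; above [B] the power is continued
    by a line of slope [B ^ (p - 2)], and below 0 by 0. *)
Definition force (u : R) : R :=
  u - clamp u `^ (p - 1) - B `^ (p - 2) * (Num.max u B - B).

Lemma lipschitz_wlog (f : R -> R) L :
  (forall u v, u <= v -> `|f u - f v| <= L * (v - u)) ->
  forall u v, `|f u - f v| <= L * `|u - v|.
Proof.
move=> h u v; case: (leP u v) => uv.
  by rewrite (distrC u) (ger0_norm (_ : 0 <= v - u)) ?subr_ge0 //; exact: h.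
rewrite (distrC (f u)) (ger0_norm (_ : 0 <= u - v)) ?subr_ge0 ?(ltW uv) //.
exact/h/ltW.
Qed.

Lemma powR_le (u v r : R) : 0 <= r -> 0 <= u -> u <= v -> u `^ r <= v `^ r.
Proof.
move=> r0 u0 uv; apply: ge0_ler_powR => //; rewrite nnegrE //.
exact: le_trans u0 uv.
Qed.

Lemma powR_ge1 (u r : R) : 0 <= r -> 1 <= u -> 1 <= u `^ r.
Proof. by move=> r0 u1; have := powR_le r0 ler01 u1; rewrite powR1. Qed.

Lemma powR_le1 (u r : R) : 0 <= r -> 0 <= u -> u <= 1 -> u `^ r <= 1.
Proof. by move=> r0 u0 u1; have := powR_le r0 u0 u1; rewrite powR1. Qed.

Lemma powR_lipschitz u v : 0 <= u -> u <= v -> v <= B ->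
  `|u `^ (p - 1) - v `^ (p - 1)| <= (p - 1) * B `^ (p - 2) * (v - u).
Proof.
move=> u0 uv vB; have p2' := p2.
have uB := le_trans uv vB.
have p10 : p - 1 != 0 by rewrite gt_eqF //; lra.
have le_pow w : 0 <= w -> w <= B -> w `^ (p - 2) <= B `^ (p - 2).
  move=> w0 wB; by apply: powR_le => //; lra.
move: u0; rewrite le_eqVlt => /predU1P[u0|u0].
  rewrite -u0 powR0 // sub0r normrN subr0 ger0_norm ?powR_ge0 //.
  have v0 : 0 <= v by rewrite u0.
  rewrite -(mulr_powRB1 v0) ?subr_gt0; last lra.
  have -> : p - 1 - 1 = p - 2 by ring.
  rewrite mulrC ler_wpM2r //.
  have := le_pow v v0 vB; have := powR_ge0 B (p - 2); nra.
rewrite distrC mulrBr; apply: (@derive_norm_le R (fun x => x `^ (p - 1))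
  (fun x => (p - 1) * x `^ (p - 1 - 1)) (fun x => (p - 1) * B `^ (p - 2) * x)
  (fun=> (p - 1) * B `^ (p - 2))) => // x /andP[ux xv].
- exact/is_derive1_powR/(lt_le_trans u0).
- exact: is_derive_linear.
have x0 : 0 <= x by rewrite ltW // (lt_le_trans u0).
have -> : p - 1 - 1 = p - 2 by ring.
rewrite ger0_norm ?mulr_ge0 ?powR_ge0 //; last lra.
by rewrite ler_wpM2l ?le_pow ?(le_trans xv) //; lra.
Qed.

Lemma clamp_id u : 0 <= u <= B -> clamp u = u.
Proof. by move=> /andP[u0 uB]; rewrite /clamp min_l // max_r. Qed.

Lemma clampE u : clamp u = if u <= 0 then 0 else if u <= B then u else B.
Proof.
have B1' := B1; rewrite /clamp.
case: (leP u 0) => u0; first by rewrite min_l ?max_l //; lra.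
case: (leP u B) => uB; first by rewrite max_r // ltW.
by rewrite max_r //; lra.
Qed.

Lemma clamp_mono u v : u <= v ->
  [/\ 0 <= clamp u, clamp u <= clamp v, clamp v <= B & clamp v - clamp u <= v - u].
Proof.
have B1' := B1; move=> uv; rewrite !clampE.
by case: (leP u 0) => u0; case: (leP u B) => uB; case: (leP v 0) => v0;
  case: (leP v B) => vB; split; lra.
Qed.

Definition force_lip : R := 1 + (p - 1) * B `^ (p - 2) + B `^ (p - 2).

Lemma force_lip_ge0 : 0 <= force_lip.
Proof. by have p2' := p2; have := powR_ge0 B (p - 2); rewrite /force_lip; nra. Qed.

Lemma force_lipschitz u v : `|force u - force v| <= force_lip * `|u - v|.
Proof.
move: u v; apply: lipschitz_wlog => u v uv.
have [c0 cuv cB cd] := clamp_mono uv.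
have h1 := powR_lipschitz c0 cuv cB.
have p2' := p2; have b0 := powR_ge0 B (p - 2).
have h1' : `|clamp u `^ (p - 1) - clamp v `^ (p - 1)| <= (p - 1) * B `^ (p - 2) * (v - u).
  apply: le_trans h1 _; rewrite ler_wpM2l // mulr_ge0 //; lra.
have h2 : 0 <= Num.max v B - Num.max u B <= v - u.
  by case: (leP u B) => uB; case: (leP v B) => vB; apply/andP; split; lra.
move: h1'; rewrite /force /force_lip !ler_norml; move: (clamp u `^ _) (clamp v `^ _) => a b.
move: (Num.max v B) (Num.max u B) h2 (B `^ (p - 2)) b0 => c d /andP[h2 h3] K K0 /andP[h4 h5].
have h6 : K * (c - d) <= K * (v - u) by rewrite ler_wpM2l.
have h7 : 0 <= K * (c - d) by rewrite mulr_ge0.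
by apply/andP; split; lra.
Qed.

Lemma force0 : force 0 = 0.
Proof.
have B1' := B1; have p2' := p2.
rewrite /force clampE lexx powR0 ?max_r ?subrr ?mulr0 ?subr0 //; first lra.
by rewrite gt_eqF //; lra.
Qed.

Lemma forceE u : 0 <= u <= B -> force u = u - u `^ (p - 1).
Proof.
move=> uB; rewrite /force clamp_id // max_r ?subrr ?mulr0 ?subr0 //.
by case/andP: uB.
Qed.

Lemma continuous_force : continuous force.
Proof. exact: (lipschitz_continuous force_lip_ge0 force_lipschitz). Qed.

Lemma powRB1_split u : 0 < u -> u `^ (p - 1) = u * u `^ (p - 2).
Proof.
move=> u0; have p2' := p2; have -> : p - 2 = p - 1 - 1 by ring.
by rewrite mulr_powRB1 ?(ltW u0) //; lra.
Qed.

Lemma force_le0 u : 1 <= u -> force u <= 0.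
Proof.
move=> u1; have u0 : 0 < u by lra.
have B1' := B1; have p2' := p2; case: (leP u B) => uB.
  rewrite forceE ?uB ?andbT ?(ltW u0) // powRB1_split //.
  have : 1 <= u `^ (p - 2) by apply: powR_ge1; lra.
  by move: (u `^ _) => K; nra.
have B0 : 0 < B by lra.
rewrite /force clampE (lt_geF u0) (lt_geF uB) max_l ?(ltW uB) // powRB1_split //.
have : 1 <= B `^ (p - 2) by apply: powR_ge1; lra.
by move: (B `^ _) => K; nra.
Qed.

Lemma force_ge0 u : 0 <= u <= 1 -> 0 <= force u.
Proof.
move=> /andP[u0 u1]; have B1' := B1; have p2' := p2.
rewrite forceE; last by apply/andP; split; lra.
move: u0; rewrite le_eqVlt => /predU1P[<-|u0].
  by rewrite powR0 ?subr0 // gt_eqF //; lra.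
rewrite powRB1_split //.
have : u `^ (p - 2) <= 1 by apply: powR_le1; lra.
by move: (u `^ _) => K; nra.
Qed.

(** [u (1 - u ^ (p - 2))] decreases for [u >= 1], which gives a bound that is
    uniform above [d]. *)
Lemma force_lt0 d u : 1 < d -> d <= u -> u <= B -> force u <= d * (1 - d `^ (p - 2)).
Proof.
move=> d1 du uB; have p2' := p2.
rewrite forceE; last by apply/andP; split; lra.
rewrite powRB1_split; last lra.
have : d `^ (p - 2) <= u `^ (p - 2) by rewrite powR_le //; lra.
have : 1 <= d `^ (p - 2) by apply: powR_ge1; lra.
by move: (u `^ _) (d `^ _) => K L ? ?; nra.
Qed.

Definition potential : R -> R := prim force.

Lemma is_derive_potential (x : R) : is_derive x 1 potential (force x).
Proof. exact/is_derive_prim/continuous_force. Qed.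

Lemma potential_nondec u v : 0 <= u -> u <= v -> v <= 1 -> potential u <= potential v.
Proof.
move=> u0 uv v1; apply: (@derive_ge0_le R _ force) => // x /andP[ux xv].
  exact: is_derive_potential.
by apply: force_ge0; rewrite (le_trans u0) // (le_trans xv).
Qed.

(** This holds also above the truncation level, where it is used to show that
    solutions do not reach that level. *)
Lemma potential_noninc u v : 1 <= u -> u <= v -> potential v <= potential u.
Proof.
move=> u1 uv.
have := @derive_ge0_le R (fun x => -1 * potential x) (fun x => -1 * force x) u v uv.
move=> h; have {h}: -1 * potential u <= -1 * potential v.
  apply: h => x /andP[ux xv]; first by apply/is_deriveZf; exact: is_derive_potential.
  by have := force_le0 (le_trans u1 ux); lra.
by lra.
Qed.

Lemma potential_quad u : 0 <= u -> `|potential u| <= force_lip * u ^+ 2.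
Proof.
move=> u0.
have := @derive_norm_le R potential force (fun x => force_lip * x ^+ 2) (fun x => force_lip * (2 * x * 1)) 0 u u0.
rewrite /potential prim0 subr0 expr0n /= mulr0 subr0; apply=> x /andP[x0 xu].
- exact: is_derive_potential.
- by apply: is_deriveZf; apply: is_derive_sqr.
have := force_lipschitz x 0; rewrite force0 !subr0 (ger0_norm x0) => h.
by apply: le_trans h _; rewrite ler_wpM2l ?force_lip_ge0 //; lra.
Qed.

(** The difference of the two sides is constant for [u > 0], and it is bounded by
    a multiple of [u ^ 2], so the constant is 0.  The formula is not differentiated
    at 0, where the real power is only one-sided. *)
Lemma potentialE u : 0 <= u <= B -> potential u = u ^+ 2 / 2 - u `^ p / p.
Proof.
move=> /andP[]; rewrite le_eqVlt => /predU1P[<-|u0] uB; have p2' := p2.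
  rewrite /potential prim0 expr0n /= powR0 ?mul0r ?subr0 // gt_eqF //; lra.
pose D x : R := potential x - (x ^+ 2 / 2 - x `^ p / p).
suff : D u = 0 by rewrite /D => /eqP; rewrite subr_eq0 => /eqP.
have Dcst e : 0 < e -> e <= u -> D u = D e.
  move=> e0 eu; have d0 x : e <= x <= u -> is_derive x 1 D (force x - (2^-1 * (2 * x * 1) - p^-1 * (p * x `^ (p - 1)))).
    move=> /andP[ex xu]; apply: is_deriveBf; first exact: is_derive_potential.
    apply: is_deriveBf.
      rewrite (_ : (fun t : R => t ^+ 2 / 2) = (fun t : R => 2^-1 * t ^+ 2)); last first.
        by apply/funext => t; rewrite mulrC.
      by apply: is_deriveZf; apply: is_derive_sqr.
    rewrite (_ : (fun t : R => t `^ p / p) = (fun t : R => p^-1 * t `^ p)); last first.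
      by apply/funext => t; rewrite mulrC.
    by apply: is_deriveZf; apply: is_derive1_powR; lra.
  have := @derive_norm_le R D _ (fun=> 0) (fun=> 0) e u eu d0 (fun x _ => is_derive_cstf 0 x).
  rewrite subrr => h; apply/eqP; rewrite -subr_eq0 -normr_le0; apply: h.
  move=> x /andP[ex xu]; rewrite forceE; last by apply/andP; split; lra.
  have pn0 : p != 0 by rewrite gt_eqF //; lra.
  by rewrite mulKf // normr_le0; apply/eqP; field.
apply/eqP/negPn/negP; rewrite -normr_gt0 => D0.
pose C := force_lip + 1.
have C0 : 0 < C by have := force_lip_ge0; rewrite /C; lra.
pose e := Num.min (Num.min u 1) (`|D u| / C / 2).
have e0 : 0 < e by rewrite !lt_min u0 ltr01 !divr_gt0.
have [eu e1 eD] : [/\ e <= u, e <= 1 & e <= `|D u| / C / 2].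
  by split; rewrite /e !ge_min lexx ?orbT.
have : `|D u| <= C * e ^+ 2.
  rewrite (Dcst e) // /D; apply: le_trans (ler_normB _ _) _.
  rewrite /C mulrDl lerD ?potential_quad ?(ltW e0) // mul1r.
  have ep : e `^ p / p <= e ^+ 2 / 2.
    have : e `^ p <= e ^+ 2.
      rewrite -powR_mulrn ?(ltW e0) //; apply: ger_powR; rewrite ?e0 //; lra.
    have := powR_ge0 e p; move: (e `^ p) => K K0 h.
    rewrite ler_pM //; first by rewrite invr_ge0; lra.
    by rewrite lef_pV2 ?posrE //; lra.
  have ep0 : 0 <= e `^ p / p by rewrite divr_ge0 ?powR_ge0 //; lra.
  by have := sqr_ge0 e; rewrite ler_norml; move: (e `^ p / p) (e ^+ 2) ep ep0 => a b; lra.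
move: eD; rewrite ler_pdivlMr // ler_pdivlMr // => eD h.
have eC : C * e ^+ 2 <= C * e by rewrite ler_wpM2l ?(ltW C0) // expr2; nra.
move: D0 h eD; move: `|D u| => d D0 h eD.
have := mulr_gt0 C0 e0; lra.
Qed.

End TruncatedForce.

(** * Real profiles on the edges *)

Section Interface.
Context {R : realType}.
Variables p lam : R.

Definition nls_on (I : set R) (w z : R -> R) := forall x : R, I x ->
  [/\ 0 < w x, is_derive x 1 w (z x) & is_derive x 1 z (lam * w x - w x `^ (p - 1))].

(** A positive solution on an edge of length [l], even with respect to its midpoint,
    with value [c] and outgoing slope [s] at the vertex, and with mass [M]. *)
Definition edge_profile (l c s M : R) (w z : R -> R) :=
  [/\ nls_on `[0, l] w z, w 0 = c /\ z 0 = s,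
     forall x, 0 <= x <= l -> w (l - x) = w x /\ z (l - x) = - z x &
     exists2 m, forall x : R, 0 <= x <= l -> is_derive x 1 m (w x ^+ 2) & m l - m 0 = M].

(** The bound of the derivative by the function itself makes it square integrable. *)
Definition half_line_profile (c s M : R) (w z : R -> R) :=
  [/\ nls_on `[0, +oo[ w z, w 0 = c /\ z 0 = s,
     exists C, forall x, 0 <= x -> `|z x| <= C * w x &
     exists2 m, forall x : R, 0 <= x -> is_derive x 1 m (w x ^+ 2) &
       m x @[x --> +oo] --> m 0 + M].

End Interface.

(** * Energy of the rescaled equation *)

Section Profile.
Context {R : realType}.
Variable p : R.
Hypothesis p2 : 2 < p.

Definition kappa := (p - 2) / 2.
Lemma kappa_gt0 : 0 < kappa.
Proof. by rewrite /kappa divr_gt0 // subr_gt0. Qed.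

Local Notation M0 := (soliton_max kappa).
Local Notation sol := (soliton kappa).
Local Notation dsol := (dsoliton kappa).

(** Large enough for its potential to lie below minus every energy that occurs:
    the first term bounds the energy, and the second one makes the power dominate
    the quadratic term. *)
Definition cutoff : R := 3 * M0 + p `^ (p - 2)^-1.

Lemma soliton_max_gt1_kappa : 1 < M0. Proof. exact/soliton_max_gt1/kappa_gt0. Qed.

Lemma cutoff_ge : 3 * M0 <= cutoff.
Proof. by rewrite /cutoff lerDl powR_ge0. Qed.

Lemma cutoff_ge1 : 1 <= cutoff.
Proof. by have := cutoff_ge; have := soliton_max_gt1_kappa; lra. Qed.

Local Notation g := (force p cutoff).
Local Notation pot := (potential p cutoff).
Local Notation Lg := (force_lip p cutoff).
Local Notation Lg0 := (force_lip_ge0 cutoff p2).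
Local Notation gL := (force_lipschitz p2 cutoff_ge1).
Local Notation g0 := (force0 p2 cutoff_ge1).
(* Position, velocity and accumulated mass of the solution with data (c, s) at 0. *)
Local Notation Y := (position Lg0 gL g0).
Local Notation Z := (velocity Lg0 gL g0).
Local Notation Q := (sqmass Lg0 gL g0).

Lemma potential_cutoff : pot cutoff < - (4 * M0 ^+ 2).
Proof.
have p2' := p2; have b1 := cutoff_ge1; have b3 := cutoff_ge; have m1 := soliton_max_gt1_kappa.
rewrite (potentialE p2 cutoff_ge1); last by apply/andP; split; lra.
have : p <= cutoff `^ (p - 2).
  have q0 : 0 <= p `^ (p - 2)^-1 by exact: powR_ge0.
  have h : p `^ (p - 2)^-1 <= cutoff by rewrite /cutoff lerDr mulr_ge0 // ltW // (lt_trans ltr01).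
  have := @powR_le _ _ _ (p - 2) _ q0 h; rewrite -powRrM mulVf ?gt_eqF ?subr_gt0 //.
  by rewrite powRr1; [apply; lra|lra].
have -> : cutoff `^ p = cutoff ^+ 2 * cutoff `^ (p - 2).
  rewrite -powR_mulrn; last lra.
  rewrite -powRD; first by congr (_ `^ _); ring.
  by apply/implyP => _; rewrite gt_eqF //; lra.
move=> h; have p0 : 0 < p by lra.
have : 1 <= cutoff `^ (p - 2) / p by rewrite ler_pdivlMr // mul1r.
rewrite -mulrA; move: (_ / p) => K K1; nra.
Qed.

Lemma potential_le_cutoff u : - (4 * M0 ^+ 2) <= pot u -> u <= cutoff.
Proof.
move=> h; rewrite leNgt; apply/negP => hu.
have := potential_noninc p2 cutoff_ge1 cutoff_ge1 (ltW hu); have := potential_cutoff; lra.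
Qed.

Lemma force_neg u : 1 < u -> u <= cutoff -> g u < 0.
Proof.
have p2' := p2; move=> u1 ub; apply: le_lt_trans (force_lt0 p2 u1 (lexx u) ub) _.
rewrite pmulr_rlt0 ?subr_lt0; last lra.
have h := @gt0_ltr_powR _ (p - 2) _ 1 u; rewrite powR1 in h.
by apply: h; rewrite ?nnegrE //; lra.
Qed.

Lemma newton_energy y z T t : newton g T y z -> 0 <= t <= T ->
  z t ^+ 2 / 2 - pot (y t) = z 0 ^+ 2 / 2 - pot (y 0).
Proof.
move=> h /andP[t0 tT].
apply/eqP; rewrite -subr_eq0 -normr_le0.
have := @derive_norm_le R (fun t => 2^-1 * z t ^+ 2 - pot (y t))
  (fun t => 2^-1 * (2 * z t * g (y t)) - g (y t) * z t) (fun=> 0) (fun=> 0) 0 t t0 _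
  (fun x _ => is_derive_cstf 0 x).
rewrite subrr ![_ / 2]mulrC; apply=> x /andP[x0 xt].
  have [dy dz] : is_derive x 1 y (z x) /\ is_derive x 1 z (g (y x)).
    by apply: h; rewrite x0 (le_trans xt).
  apply: is_deriveBf; first by apply: is_deriveZf; apply: is_derive_sqr.
  by apply: is_derive_compf dy; exact: (is_derive_potential p2 cutoff_ge1).
by rewrite normr_le0; apply/eqP; field.
Qed.

Lemma flow_energy c s t : 0 <= t ->
  Z c s t ^+ 2 / 2 - pot (Y c s t) = s ^+ 2 / 2 - pot c.
Proof.
move=> t0; have := newton_energy (@newton_position _ _ _ Lg0 gL g0 c s t) (_ : 0 <= t <= t).
by rewrite position0 velocity0; apply; rewrite t0 lexx.
Qed.

Lemma soliton_le_cutoff x : sol x <= cutoff.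
Proof.
have := soliton_le_max kappa_gt0 x; have := cutoff_ge; have := soliton_max_gt1_kappa; lra.
Qed.

Lemma soliton_range x : 0 <= sol x <= cutoff.
Proof. by rewrite (ltW (soliton_gt0 _ _)) soliton_le_cutoff. Qed.

Lemma soliton_newton t0 T :
  newton g T (fun t => sol (t + t0)) (fun t => dsol (t + t0)).
Proof.
move=> t _; have da : is_derive t 1 (fun t : R => t + t0) 1.
  have := is_derive_affine 1 t0 t.
  by rewrite (_ : (fun t : R => 1 * t + t0) = (fun t : R => t + t0)) //;
    apply/funext => x; rewrite mul1r.
split.
  have := @is_derive_compf R sol (fun t => t + t0) t _ _ (is_derive_soliton kappa_gt0 (t + t0)) da.
  by rewrite mulr1.
have := @is_derive_compf R dsol (fun t => t + t0) t _ _ (is_derive_dsoliton kappa_gt0 (t + t0)) da.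
rewrite mulr1 forceE ?soliton_range //; by have -> : 2 * kappa + 1 = p - 1 by rewrite /kappa; field.
Qed.

Lemma soliton_small e : 0 < e -> exists2 t, 0 <= t & forall x, t <= x -> sol x < e.
Proof.
move=> e0; have [C C0 hC] := soliton_decay kappa_gt0.
exists (C / e); first by rewrite divr_ge0 // ltW.
move=> x hx; apply: le_lt_trans (hC x) _.
rewrite expRN -ltr_pdivlMr ?invr_gt0 ?expR_gt0 // invrK.
have := expR_ge1Dx x; move: hx; rewrite ler_pdivrMr // => hx.
have e1 := expR_gt0 x; rewrite mulrC; move=> h; nra.
Qed.

(** The energy is constant along the soliton and tends to 0 with it. *)
Lemma soliton_energy x : 0 <= x -> dsol x ^+ 2 / 2 = pot (sol x).
Proof.
move=> x0; apply/eqP; rewrite -subr_eq0; apply/eqP.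
set E := _ - _.
have Et t : 0 <= t -> E = dsol (t + x) ^+ 2 / 2 - pot (sol (t + x)).
  move=> t0; have := newton_energy (@soliton_newton x t) (_ : 0 <= t <= t).
  by rewrite add0r => ->; rewrite ?t0 ?lexx.
apply/eqP/negPn/negP; rewrite -normr_gt0 => E0.
have l0 := Lg0.
pose e := Num.min 1 (`|E| / (1 + Lg)).
have e0 : 0 < e by rewrite lt_min ltr01 divr_gt0 //; lra.
have [t t0 ht] := soliton_small e0.
have tx : 0 <= t + x by rewrite addr_ge0.
have h1 := ht (t + x); have h2 := dsoliton_norm kappa_gt0 tx.
have h3 := soliton_gt0 kappa (t + x).
have h4 := potential_quad p2 cutoff_ge1 (ltW h3).
have {}h1 : sol (t + x) < e by apply: h1; lra.
have e1 : e <= 1 by rewrite ge_min lexx.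
have eE : e * (1 + Lg) <= `|E|.
  by rewrite -ler_pdivlMr; [rewrite ge_min lexx orbT|lra].
have h5 : dsol (t + x) ^+ 2 <= sol (t + x) ^+ 2.
  by rewrite -(real_normK (num_real (dsol _))) ler_sqr ?nnegrE // ltW.
have : `|E| <= (1 + Lg) * sol (t + x) ^+ 2.
  rewrite (Et t t0); apply: le_trans (ler_normB _ _) _.
  rewrite mulrDl mul1r lerD // ger0_norm ?divr_ge0 ?sqr_ge0 //.
  by have := sqr_ge0 (dsol (t + x)); lra.
have : (1 + Lg) * sol (t + x) ^+ 2 < (1 + Lg) * e by rewrite ltr_pM2l; nra.
lra.
Qed.

(** The kinetic energy is nonnegative, so the potential stays above minus the
    energy, that is above the potential of the cutoff. *)
Lemma position_le_cutoff c s t : s ^+ 2 / 2 - pot c <= 4 * M0 ^+ 2 -> 0 <= t -> Y c s t <= cutoff.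
Proof.
move=> E t0; apply: (potential_le_cutoff); have := flow_energy c s t0.
have := sqr_ge0 (Z c s t); lra.
Qed.

Definition first_max c s : R := inf [set t | 0 <= t /\ Z c s t <= 0].

(** * The first maximum of a solution *)

Section FirstMax.
Variables c s : R.
Hypotheses (c0 : 0 < c) (s0 : 0 < s) (E : s ^+ 2 / 2 - pot c <= 4 * M0 ^+ 2).
Let T := first_max c s.
Let S := [set t : R | 0 <= t /\ Z c s t <= 0].

Lemma position_increasing t1 t2 : 0 <= t1 -> t1 <= t2 ->
  (forall t, t1 <= t <= t2 -> 0 <= Z c s t) -> Y c s t1 <= Y c s t2.
Proof.
move=> t10 t12 h; apply: (@derive_ge0_le R _ (Z c s)) => // x /andP[x1 _].
by apply: is_derive_position; exact: le_trans x1.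
Qed.

(** A solution with positive velocity forever would pass 1: below 1 the potential
    increases, so the velocity stays at least [s].  Above 1 the force is negative
    and bounded away from 0, so the velocity would become negative. *)
Lemma first_max_nonempty : S !=set0.
Proof.
apply: contrapT => no; have s0' := s0; have c0' := c0.
have Zpos t : 0 <= t -> 0 < Z c s t.
  by move=> t0; rewrite ltNge; apply/negP => h; apply: no; exists t.
have Yc t : 0 <= t -> c <= Y c s t.
  move=> t0; rewrite -[leLHS](position0 Lg0 gL g0 c s); apply: position_increasing => // x /andP[x0 _].
  exact/ltW/Zpos.
have [t1 t10 Y1] : exists2 t, 0 <= t & 1 < Y c s t.
  apply: contrapT => small.
  have Y1 t : 0 <= t -> Y c s t <= 1.
    by move=> t0; rewrite leNgt; apply/negP => h; apply: small; exists t.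
  have Zs t : 0 <= t -> s <= Z c s t.
    move=> t0; have := flow_energy c s t0.
    have := potential_nondec p2 cutoff_ge1 (ltW c0) (Yc t t0) (Y1 t t0) => h1 h2.
    by rewrite -ler_sqr ?nnegrE ?(ltW s0) ?(ltW (Zpos t t0)) //; lra.
  have t0 : 0 <= 1 / s by rewrite divr_ge0 // ltW.
  have := @derive_le R (fun t => s * t) (fun=> s) (Y c s) (Z c s) 0 (1 / s) t0.
  rewrite position0 mulr0 subr0 (_ : s * (1 / s) = 1) => [h|]; last first.
    by field; rewrite gt_eqF.
  have {h} : 1 <= Y c s (1 / s) - c.
    apply: h => x /andP[x0 _]; [exact: is_derive_linear|exact: is_derive_position|exact: Zs].
  by have := Y1 _ t0; lra.
have hY t : t1 <= t -> Y c s t1 <= Y c s t.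
  by move=> tt; apply: position_increasing => // x /andP[x0 _]; apply/ltW/Zpos/(le_trans t10).
pose d := Y c s t1; pose e := d * (1 - d `^ (p - 2)).
have e0 : e < 0.
  have p2' := p2; rewrite /e pmulr_rlt0 ?subr_lt0; last by rewrite /d; lra.
  have h := @gt0_ltr_powR _ (p - 2) _ 1 d; rewrite powR1 in h.
  by apply: h; rewrite ?nnegrE /d; lra.
have Zle t : t1 <= t -> Z c s t - Z c s t1 <= e * t - e * t1.
  move=> tt; apply: (@derive_le R (Z c s) (fun t => g (Y c s t)) (fun t => e * t) (fun=> e)) => // x /andP[x1 xt].
  - by apply: is_derive_velocity; exact: le_trans x1.
  - exact: is_derive_linear.
  apply: (force_lt0 p2 Y1 (hY _ x1)); apply: position_le_cutoff => //.
  exact: le_trans x1.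
(* By this time the deceleration would have used up the velocity. *)
pose t2 := t1 + Z c s t1 / - e.
have t12 : t1 <= t2.
  by rewrite lerDl divr_ge0 ?oppr_ge0 ?(ltW e0) // ltW ?Zpos.
have := Zle t2 t12; have := Zpos t2 (le_trans t10 t12).
have -> : e * t2 - e * t1 = - Z c s t1.
  by rewrite /t2; field; rewrite lt_eqF.
lra.
Qed.

(** The position at the first zero of the velocity exceeds 1, since up to 1 the
    potential increases and conservation of energy keeps the speed positive. *)
Lemma first_maxP : [/\ 0 < T, Z c s T = 0, forall t, 0 <= t < T -> 0 < Z c s t & 1 < Y c s T].
Proof.
have s0' := s0; have c0' := c0.
have lbS : has_lbound S by exists 0 => t [].
have infS : has_inf S by split; [exact: first_max_nonempty|].
have T0 : 0 <= T by apply: lb_le_inf; [exact: first_max_nonempty|move=> t []].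
have Zpos t : 0 <= t < T -> 0 < Z c s t.
  move=> /andP[t0 tT]; rewrite ltNge; apply/negP => h.
  by move: tT; rewrite ltNge; apply/negP/negPn; apply: ge_inf.
have ZT0 : Z c s T <= 0.
  rewrite leNgt; apply/negP => h.
  have [r r0 hr] := continuous_near (is_derive_continuous (is_derive_velocity Lg0 gL g0 c s T0)) h.
  have : T + r <= T.
    apply: lb_le_inf; first exact: first_max_nonempty.
    move=> t [t0 Zt]; rewrite leNgt; apply/negP => tr.
    have Tt : T <= t by apply: ge_inf.
    have := hr t; rewrite ltr_norml ltr_norml => hh.
    have /andP[] : - Z c s T < Z c s T - Z c s t < Z c s T.
      by apply: hh; apply/andP; split; lra.
    lra.
  lra.
have Tgt0 : 0 < T.
  rewrite lt_def T0 andbT; apply/eqP => TE.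
  by move: ZT0; rewrite TE velocity0; lra.
have ZT : Z c s T = 0.
  apply/le_anti; rewrite ZT0 /= leNgt; apply/negP => h.
  have h' : 0 < - Z c s T by rewrite oppr_gt0.
  have [r r0 hr] := continuous_near (is_derive_continuous (is_derive_velocity Lg0 gL g0 c s T0)) h'.
  pose t := T - Num.min T r / 2.
  have m0 : 0 < Num.min T r by rewrite lt_min Tgt0.
  have m1 : Num.min T r <= T by rewrite ge_min lexx.
  have m2 : Num.min T r <= r by rewrite ge_min lexx orbT.
  have : 0 < Z c s t by apply: Zpos; rewrite /t; apply/andP; split; lra.
  have := hr t; rewrite !ltr_norml => hh.
  have /andP[] : - - Z c s T < Z c s T - Z c s t < - Z c s T.
    by apply: hh; rewrite /t; apply/andP; split; lra.
  lra.
split => //; rewrite ltNge; apply/negP => Y1.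
have Yc : c <= Y c s T.
  rewrite -[leLHS](position0 Lg0 gL g0 c s); apply: position_increasing => // x /andP[x0].
  by rewrite le_eqVlt => /predU1P[->|xT]; [rewrite ZT|rewrite ltW // Zpos // x0].
have := potential_nondec p2 cutoff_ge1 (ltW c0) Yc Y1.
have := flow_energy c s T0; rewrite ZT expr0n /= mul0r sub0r.
have : 0 < s ^+ 2 by rewrite exprn_gt0.
lra.
Qed.

End FirstMax.

(** * Solutions parametrized by the starting point and the splitting of slopes *)

(** A parameter [q = (t0, k)] consists of the abscissa [t0] on the soliton at which
    the half-line starts, and of the fraction [k] of the slope that goes to the
    longer segment. *)
Definition vertex_value (q : R * R) : R := sol q.1.
Definition tail_slope (q : R * R) : R := - dsol q.1.
Definition slope_long (q : R * R) : R := q.2 * tail_slope q.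
(** The two slopes add up to the one lost on the half-line: Kirchhoff's condition. *)
Definition slope_short (q : R * R) : R := (1 - q.2) * tail_slope q.
Definition time_to_max (q : R * R) : R := first_max (vertex_value q) (slope_long q).
(** An open set containing the rectangle in which the solution is sought; the bound
    3 only serves to bound the energy. *)
Definition admissible (q : R * R) := 0 < q.1 /\ 0 < q.2 < 3.

Lemma vertex_value_gt0 q : 0 < vertex_value q. Proof. exact: soliton_gt0. Qed.

Lemma tail_slope_gt0 q : admissible q -> 0 < tail_slope q.
Proof. by move=> [q1 _]; rewrite /tail_slope oppr_gt0; exact: (dsoliton_lt0 kappa_gt0 q1). Qed.

Lemma slope_long_gt0 q : admissible q -> 0 < slope_long q.
Proof. by move=> dq; apply: mulr_gt0; [case: dq => _ /andP[]|exact: tail_slope_gt0]. Qed.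

Lemma tail_slope_le q : admissible q -> tail_slope q <= vertex_value q.
Proof.
move=> [q1 _]; have := dsoliton_norm kappa_gt0 (ltW q1).
by rewrite ler_norml => /andP[]; rewrite /tail_slope /vertex_value; lra.
Qed.

Lemma potential_vertex_value q : admissible q -> pot (vertex_value q) = tail_slope q ^+ 2 / 2.
Proof. by move=> [q1 _]; rewrite /vertex_value -(soliton_energy (ltW q1)) /tail_slope [in RHS]sqrrN. Qed.

Lemma energyE q x : admissible q ->
  (x * tail_slope q) ^+ 2 / 2 - pot (vertex_value q) = (x ^+ 2 - 1) * tail_slope q ^+ 2 / 2.
Proof. by move=> dq; rewrite potential_vertex_value //; field. Qed.

(** The vertex has energy 0 on the soliton, so only the factor [x] matters.  The
    value 9 bounds the squares of both fractions of slope on the admissible set. *)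
Lemma energy_bound q x : admissible q -> x ^+ 2 <= 9 ->
  (x * tail_slope q) ^+ 2 / 2 - pot (vertex_value q) <= 4 * M0 ^+ 2.
Proof.
move=> dq x9; rewrite energyE //.
have s0 := tail_slope_gt0 dq; have sM : tail_slope q <= M0.
  exact: le_trans (tail_slope_le dq) (soliton_le_max kappa_gt0 _).
have : tail_slope q ^+ 2 <= M0 ^+ 2.
  by rewrite ler_sqr ?nnegrE ?(ltW s0) // (le_trans (ltW s0)).
have := sqr_ge0 (tail_slope q); move: (tail_slope q ^+ 2) (x ^+ 2) x9 => a b; nra.
Qed.

Lemma time_to_maxP q : admissible q -> [/\ 0 < time_to_max q, Z (vertex_value q) (slope_long q) (time_to_max q) = 0,
  forall t, 0 <= t < time_to_max q -> 0 < Z (vertex_value q) (slope_long q) t &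
  1 < Y (vertex_value q) (slope_long q) (time_to_max q)].
Proof.
move=> dq; apply: first_maxP; [exact: vertex_value_gt0|exact: slope_long_gt0|].
apply: energy_bound => //; case: dq => _ /andP[]; nra.
Qed.

Lemma continuous_vertex_value q : {for q, continuous vertex_value}.
Proof.
apply: (@continuous_comp _ _ _ fst sol); first exact: cvg_fst.
exact: (is_derive_continuous (is_derive_soliton kappa_gt0 q.1)).
Qed.

Lemma continuous_tail_slope q : {for q, continuous tail_slope}.
Proof.
apply: (@continuous_comp _ _ _ fst (fun x => - dsol x)); first exact: cvg_fst.
apply: continuousN; exact: (is_derive_continuous (is_derive_dsoliton kappa_gt0 q.1)).
Qed.

Lemma continuous_slope_long q : {for q, continuous slope_long}.
Proof. by apply: continuousM; [exact: cvg_snd|exact: continuous_tail_slope]. Qed.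

Lemma continuous_slope_short q : {for q, continuous slope_short}.
Proof.
apply: continuousM; last exact: continuous_tail_slope.
by apply: continuousB; [exact: cvg_cst|exact: cvg_snd].
Qed.

Lemma near_admissible q : admissible q -> \forall q' \near q, admissible q'.
Proof.
move=> [q1 /andP[q2 q3]].
near=> q'; split; last (apply/andP; split); near: q'.
- exact: (@cvgr_gt _ _ _ _ fst _ cvg_fst _ q1).
- exact: (@cvgr_gt _ _ _ _ snd _ cvg_snd _ q2).
- exact: (@cvgr_lt _ _ _ _ snd _ cvg_snd _ q3).
Unshelve. all: by end_near. Qed.

(** The force is negative at the maximum, so the velocity vanishes transversally. *)
Lemma velocity_changes_sign q d : admissible q -> 0 < d ->
  exists2 t, time_to_max q < t < time_to_max q + d & Z (vertex_value q) (slope_long q) t < 0.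
Proof.
move=> dq d0; have [T0 ZT _ YT] := time_to_maxP dq.
set T := time_to_max q in T0 ZT YT *; set c := vertex_value q in ZT YT *; set s := slope_long q in ZT YT *.
have gT : g (Y c s T) < 0.
  apply: (force_neg) => //; apply: (position_le_cutoff); last exact: ltW.
  apply: energy_bound => //; case: dq => _ /andP[]; nra.
have cg : {for T, continuous (fun t => g (Y c s t))}.
  apply: (@continuous_comp _ _ _ (Y c s) g); last exact: (continuous_force p2 cutoff_ge1).
  by apply: is_derive_continuous; apply: is_derive_position; exact: ltW.
have gT' : 0 < - g (Y c s T) by rewrite oppr_gt0.
have [r r0 hr] := continuous_near cg gT'.
have m0 : 0 < Num.min d r by rewrite lt_min d0.
have md : Num.min d r <= d by rewrite ge_min lexx.
have mr : Num.min d r <= r by rewrite ge_min lexx orbT.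
exists (T + Num.min d r / 2); first by apply/andP; split; lra.
have TT : T < T + Num.min d r / 2 by lra.
have := @derive_gt0_lt R (fun t => -1 * Z c s t) (fun t => -1 * g (Y c s t)) _ _ TT.
rewrite ZT mulr0 => h; have {h} : 0 < -1 * Z c s (T + Num.min d r / 2).
  apply: h => x /andP[xT xd].
    by apply: is_deriveZf; apply: is_derive_velocity; lra.
  have := hr x; rewrite !ltr_norml => hh.
  have /andP[] : - - g (Y c s T) < g (Y c s T) - g (Y c s x) < - g (Y c s T).
    by apply: hh; apply/andP; split; lra.
  lra.
lra.
Qed.

Let near_neg (a b r : R) : `|a - b| < r -> r <= - b -> a <= 0.
Proof. by rewrite ltr_norml => /andP[]; lra. Qed.

Let near_pos (a b r : R) : `|a - b| < r -> r <= b -> 0 < a.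
Proof. by rewrite ltr_norml => /andP[]; lra. Qed.

(** For nearby parameters the velocity is positive until shortly before the maximum,
    by compactness, and negative at some time shortly after it. *)
Lemma continuous_time_to_max q : admissible q -> {for q, continuous time_to_max}.
Proof.
move=> dq; have [T0 ZT Zpos _] := time_to_maxP dq.
apply/cvgrPdist_lt => e e0.
pose d := Num.min e (time_to_max q) / 2.
have m0 : 0 < Num.min e (time_to_max q) by rewrite lt_min e0.
have md : Num.min e (time_to_max q) <= e by rewrite ge_min lexx.
have mr : Num.min e (time_to_max q) <= time_to_max q by rewrite ge_min lexx orbT.
have [de dT d0] : [/\ d < e, d < time_to_max q & 0 < d] by rewrite /d; split; lra.
have [t2 /andP[Tt2 t2d] Zt2] := velocity_changes_sign dq d0.
have [x0 x0T hx0] : exists2 x0, x0 \in `[0, time_to_max q - d]%R &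
    forall t, t \in `[0, time_to_max q - d]%R -> Z (vertex_value q) (slope_long q) x0 <= Z (vertex_value q) (slope_long q) t.
  apply: EVT_min; first by lra.
  apply: (@is_derive_within R _ (fun x => g (Y (vertex_value q) (slope_long q) x))) => x /andP[x0 _].
  exact: is_derive_velocity.
have m1 : 0 < Z (vertex_value q) (slope_long q) x0.
  by apply: Zpos; move: x0T; rewrite in_itv /= => /andP[? ?]; apply/andP; split; lra.
pose r := Num.min (Z (vertex_value q) (slope_long q) x0) (- Z (vertex_value q) (slope_long q) t2).
have r0 : 0 < r by rewrite lt_min m1 oppr_gt0.
have r1 : r <= Z (vertex_value q) (slope_long q) x0 by rewrite ge_min lexx.
have r2 : r <= - Z (vertex_value q) (slope_long q) t2 by rewrite ge_min lexx orbT.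
near=> q'.
have dq' : admissible q' by near: q'; exact: near_admissible.
have hq' : forall t, 0 <= t <= t2 ->
  `|Y (vertex_value q') (slope_long q') t - Y (vertex_value q) (slope_long q) t| < r /\
  `|Z (vertex_value q') (slope_long q') t - Z (vertex_value q) (slope_long q) t| < r.
  near: q'; exact: (flow_near Lg0 gL g0 (@continuous_vertex_value q) (@continuous_slope_long q) t2 r0).
have [T0' ZT' _ _] := time_to_maxP dq'.
have t20 : 0 <= t2 by apply/ltW/(lt_trans T0).
have h1 : time_to_max q' <= t2.
  apply: ge_inf; first by exists 0 => t [].
  split => //; have [|_ h] := hq' t2; first by rewrite t20 lexx.
  exact: near_neg h r2.
have h2 : time_to_max q - d < time_to_max q'.
  rewrite ltNge; apply/negP => h.
  have h3 : r <= Z (vertex_value q) (slope_long q) (time_to_max q').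
    by apply: (le_trans r1); apply: hx0; rewrite in_itv /= h (ltW T0').
  have [|_ h4] := hq' (time_to_max q'); first by rewrite (ltW T0') h1.
  by have := near_pos h4 h3; rewrite ZT' ltxx.
move: h1 h2 t2d de; move: (time_to_max q') (time_to_max q) => T' T h1 h2 t2d de.
by rewrite ltr_norml; apply/andP; split; lra.
Unshelve. all: by end_near. Qed.

Definition soliton_mass : R -> R := prim (fun x => sol x ^+ 2).
Definition soliton_mass_total : R := sup (range soliton_mass).

Lemma is_derive_soliton_mass (x : R) : is_derive x 1 soliton_mass (sol x ^+ 2).
Proof.
apply: is_derive_prim => y.
exact: (is_derive_continuous (is_derive_sqr (is_derive_soliton kappa_gt0 y))).
Qed.

Lemma soliton_mass0 : soliton_mass 0 = 0. Proof. exact: prim0. Qed.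

Lemma soliton_mass_nondec x y : x <= y -> soliton_mass x <= soliton_mass y.
Proof.
move=> xy; apply: (@derive_ge0_le R _ (fun x => sol x ^+ 2)) => // t _.
  exact: is_derive_soliton_mass.
exact: sqr_ge0.
Qed.

Lemma soliton_mass_bounded : has_ubound (range soliton_mass).
Proof.
have [C C0 hC] := soliton_decay kappa_gt0.
exists (C ^+ 2 / 2) => _ [x _ <-].
have [x0|x0] := leP x 0.
  apply: le_trans (soliton_mass_nondec x0) _; rewrite /soliton_mass prim0.
  by rewrite divr_ge0 ?sqr_ge0.
have := @derive_le R soliton_mass (fun x => sol x ^+ 2)
  (fun x => - (C ^+ 2 / 2) * expR (-2 * x)) (fun x => - (C ^+ 2 / 2) * (-2 * expR (-2 * x))) 0 x (ltW x0).
rewrite soliton_mass0 mulr0 expR0 mulr1 subr0 => h.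
have {h} : soliton_mass x <= - (C ^+ 2 / 2) * expR (-2 * x) - - (C ^+ 2 / 2).
  apply: h => t _; [exact: is_derive_soliton_mass|by apply: is_deriveZf; exact: is_derive_expRM|].
  have -> : - (C ^+ 2 / 2) * (-2 * expR (-2 * t)) = (C * expR (- t)) ^+ 2.
    rewrite exprMn -(expRM_natr 2); have -> : - t * 2%:R = -2 * t :> R by ring.
    by field.
  by rewrite ler_sqr ?nnegrE ?mulr_ge0 ?expR_ge0 ?(ltW C0) // ltW ?soliton_gt0.
have : 0 <= C ^+ 2 / 2 * expR (-2 * x) by rewrite mulr_ge0 ?expR_ge0 ?divr_ge0 ?sqr_ge0.
lra.
Qed.

Lemma soliton_mass_cvg : soliton_mass x @[x --> +oo] --> soliton_mass_total.
Proof.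
by apply: nondecreasing_cvgr; [move=> x y; exact: soliton_mass_nondec|exact: soliton_mass_bounded].
Qed.

Lemma soliton_mass_le x : soliton_mass x <= soliton_mass_total.
Proof. by apply: ub_le_sup; [exact: soliton_mass_bounded|exists x]. Qed.

Lemma soliton_mass_total_ge0 : 0 <= soliton_mass_total.
Proof. by have := soliton_mass_le 0; rewrite /soliton_mass prim0. Qed.

Section Admissible.
Variable q : R * R.
Hypothesis dq : admissible q.

Lemma long_energy : slope_long q ^+ 2 / 2 - pot (vertex_value q) <= 4 * M0 ^+ 2.
Proof. by apply: energy_bound => //; case: dq => _ /andP[]; nra. Qed.

Lemma long_ge t : 0 <= t <= time_to_max q -> vertex_value q <= Y (vertex_value q) (slope_long q) t.
Proof.
move=> /andP[t0 tT]; have [_ ZT Zpos _] := time_to_maxP dq.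
rewrite -[leLHS](position0 Lg0 gL g0 _ (slope_long q)); apply: position_increasing => // x /andP[x0 xt].
have := le_trans xt tT; rewrite le_eqVlt => /predU1P[->|xT]; first by rewrite ZT.
by rewrite ltW // Zpos // x0.
Qed.

Lemma long_le_cutoff t : 0 <= t -> Y (vertex_value q) (slope_long q) t <= cutoff.
Proof. by apply: position_le_cutoff; exact: long_energy. Qed.

(** While the solution rises from the vertex, conservation of energy gives
    [y' <= K y]; the position has to pass 1, which takes long if it starts low. *)
Lemma time_to_max_lower : 1 <= vertex_value q * expR ((9 + 4 * Lg) * time_to_max q).
Proof.
have [T0 ZT Zpos YT] := time_to_maxP dq; have c0 := vertex_value_gt0 q; have l0 := Lg0.
have s0 := slope_long_gt0 dq.
apply: le_trans (ltW YT) _; rewrite -[X in X * _](position0 Lg0 gL g0 _ (slope_long q)).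
apply: (@gronwall R _ (Z (vertex_value q) (slope_long q))); first exact: ltW.
  by move=> x /andP[x0 _]; exact: is_derive_position.
move=> x /andP[x0 xT].
have Yc : vertex_value q <= Y (vertex_value q) (slope_long q) x by apply: long_ge; rewrite x0.
have Y0 := lt_le_trans c0 Yc.
have E := flow_energy (vertex_value q) (slope_long q) x0.
have p1 := potential_quad p2 cutoff_ge1 (ltW Y0); have p3 := potential_quad p2 cutoff_ge1 (ltW c0).
move: E p1 p3 Y0 Yc; move: (Z _ _ x) (Y _ _ x) => z y E p1 p3 Y0 Yc.
have s3 : slope_long q <= 3 * vertex_value q.
  have := tail_slope_le dq; have := tail_slope_gt0 dq; rewrite /slope_long.
  by case: dq => _ /andP[]; nra.
have hy : vertex_value q ^+ 2 <= y ^+ 2 by rewrite ler_sqr ?nnegrE ?(ltW c0) ?(ltW Y0).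
have hs : slope_long q ^+ 2 <= 9 * vertex_value q ^+ 2 by nra.
have [z0|z0] := leP z 0.
  by apply: le_trans z0 _; rewrite mulr_ge0 ?(ltW Y0) //; lra.
rewrite -ler_sqr ?nnegrE ?(ltW z0) ?mulr_ge0 ?(ltW Y0) //; last lra.
have hL : Lg * vertex_value q ^+ 2 <= Lg * y ^+ 2 by rewrite ler_wpM2l.
have : z ^+ 2 <= (9 + 4 * Lg) * y ^+ 2.
  move: p1 p3; rewrite !ler_norml => /andP[p11 p12] /andP[p31 p32]; lra.
move=> h; apply: le_trans h _.
rewrite exprMn ler_wpM2r ?sqr_ge0 // expr2 -[leLHS]mulr1 ler_wpM2l //; lra.
Qed.

(** If it starts above [d > 1] the force is uniformly negative, and the initial
    slope is exhausted in a time proportional to it. *)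
Lemma time_to_max_upper d : 1 < d -> d <= vertex_value q ->
  time_to_max q * (d * (d `^ (p - 2) - 1)) <= 3 * tail_slope q.
Proof.
move=> d1 dh; have [T0 ZT Zpos YT] := time_to_maxP dq.
have := @derive_le R (Z (vertex_value q) (slope_long q)) (fun t => g (Y (vertex_value q) (slope_long q) t))
  (fun t => d * (1 - d `^ (p - 2)) * t) (fun=> d * (1 - d `^ (p - 2))) 0 (time_to_max q) (ltW T0).
rewrite ZT velocity0 => h.
have {h} : 0 - slope_long q <= d * (1 - d `^ (p - 2)) * time_to_max q - d * (1 - d `^ (p - 2)) * 0.
  apply: h => x /andP[x0 xT]; [exact: is_derive_velocity|exact: is_derive_linear|].
  apply: (force_lt0 p2 d1); last exact: long_le_cutoff.
  by apply: le_trans dh _; apply: long_ge; rewrite x0.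
have := tail_slope_gt0 dq; rewrite /slope_long; case: dq => _ /andP[q20 q23].
have : q.2 * tail_slope q <= 3 * tail_slope q by rewrite ler_wpM2r ?(ltW (tail_slope_gt0 dq)) // ltW.
lra.
Qed.

(** For [q.2 < 2] the energy is negative while it is nonnegative at a zero; for
    [q.2 = 2] the solution is the soliton. *)
Lemma short_positive t : q.2 <= 2 -> 0 <= t -> 0 < Y (vertex_value q) (slope_short q) t.
Proof.
move=> q2 t0; have c0 := vertex_value_gt0 q; have s0 := tail_slope_gt0 dq.
move: q2; rewrite le_eqVlt => /predU1P[q2|q2].
  have tt : 0 <= t <= t by rewrite t0 lexx.
  have [] := newton_unique Lg0 gL (@newton_position _ _ _ Lg0 gL g0 (vertex_value q) (slope_short q) t)
    (@soliton_newton q.1 t) _ _ tt.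
  - by rewrite position0 add0r.
  - by rewrite velocity0 add0r /slope_short /tail_slope q2; ring.
  by move=> -> _; exact: soliton_gt0.
rewrite ltNge; apply/negP => Yt.
have [x] : exists2 x, x \in `[0, t]%R & Y (vertex_value q) (slope_short q) x = 0.
  apply: IVT => //.
    apply: (@is_derive_within R _ (Z (vertex_value q) (slope_short q))) => x /andP[x0 _].
    exact: is_derive_position.
  by rewrite position0 ge_min Yt orbT le_max (ltW c0).
rewrite in_itv /= => /andP[x0 _] Yx.
have := flow_energy (vertex_value q) (slope_short q) x0.
rewrite Yx {1}/potential prim0 subr0 energyE // => h.
have := sqr_ge0 (Z (vertex_value q) (slope_short q) x).
have : ((1 - q.2) ^+ 2 - 1) * tail_slope q ^+ 2 < 0.
  rewrite pmulr_llt0 ?exprn_gt0 //; case: dq => _ /andP[]; nra.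
lra.
Qed.

Lemma short_le_cutoff t : q.2 <= 2 -> 0 <= t -> Y (vertex_value q) (slope_short q) t <= cutoff.
Proof.
move=> q2; apply: position_le_cutoff; apply: energy_bound => //.
by case: dq => _ /andP[]; nra.
Qed.

(** With fraction 2 the slope is that of the soliton, hence so is the solution. *)
Lemma short_end t : q.2 = 2 -> 0 <= t -> Z (vertex_value q) (slope_short q) t < 0.
Proof.
move=> q2 t0; have tt : 0 <= t <= t by rewrite t0 lexx.
have [] := newton_unique Lg0 gL (@newton_position _ _ _ Lg0 gL g0 (vertex_value q) (slope_short q) t)
    (@soliton_newton q.1 t) _ _ tt.
- by rewrite position0 add0r.
- by rewrite velocity0 add0r /slope_short /tail_slope q2; ring.
move=> _ ->; apply: (dsoliton_lt0 kappa_gt0); case: dq => q1 _; lra.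
Qed.

End Admissible.

(** * The two equations and their common zero *)

Section Zero.
Variables (l b mu : R).
Hypotheses (p6 : p < 6) (l0 : 0 < l) (b01 : 0 < b <= 1) (mu0 : 0 < mu).

Definition short_end_slope (q : R * R) : R := Z (vertex_value q) (slope_short q) (b * time_to_max q).
(** Twice the half-line, and the two bounded edges, each twice as long as its
    segment. *)
Definition graph_mass (q : R * R) : R :=
  Q (vertex_value q) (slope_long q) (2 * time_to_max q) + Q (vertex_value q) (slope_short q) (2 * (b * time_to_max q)) +
  2 * (soliton_mass_total - soliton_mass q.1).
Definition mass_exponent : R := 2 / kappa - 1.
(** The square root of lambda: it maps the longer edge, of length [l], to twice the
    time of the maximum. *)
Definition frequency (q : R * R) : R := 2 * time_to_max q / l.
Definition mass_excess (q : R * R) : R := frequency q `^ mass_exponent * graph_mass q - mu.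

Lemma mass_exponent_gt0 : 0 < mass_exponent.
Proof.
have k0' := kappa_gt0; rewrite /mass_exponent subr_gt0 ltr_pdivlMr // mul1r /kappa; have p6' := p6; lra.
Qed.

Section AtParameter.
Variable q : R * R.
Hypothesis dq : admissible q.

Let T0 : 0 < time_to_max q. Proof. by have [] := time_to_maxP dq. Qed.
Let cT : {for q, continuous time_to_max}. Proof. exact: continuous_time_to_max. Qed.
Let cZl a : {for q, continuous (fun q => a * time_to_max q)}.
Proof. by apply: continuousM; [exact: cvg_cst|exact: cT]. Qed.

Lemma frequency_gt0 : 0 < frequency q.
Proof. by rewrite /frequency divr_gt0 ?mulr_gt0. Qed.

Lemma continuous_short_end_slope : {for q, continuous short_end_slope}.
Proof.
have /andP[b0 _] := b01.
apply: (@continuous_at_time _ _ q (fun q => Z (vertex_value q) (slope_short q)) (fun q => b * time_to_max q)).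
- move=> t1 e e0; have := flow_near Lg0 gL g0 (@continuous_vertex_value q) (@continuous_slope_short q) t1 e0.
  by apply: filterS => q' h t tt; have [] := h t tt.
- apply: is_derive_continuous; apply: is_derive_velocity.
  by rewrite mulr_ge0 ?(ltW b0) ?(ltW T0).
- exact: cZl.
- by rewrite mulr_gt0.
Qed.

Lemma continuous_graph_mass : {for q, continuous graph_mass}.
Proof.
have /andP[b0 _] := b01.
have cM S (cS : {for q, continuous S}) (a : R) : 0 < a ->
   {for q, continuous (fun q => Q (vertex_value q) (S q) (a * time_to_max q))}.
  move=> a0; apply: (@continuous_at_time _ _ q (fun q => Q (vertex_value q) (S q)) (fun q => a * time_to_max q)).
  - by move=> t1 e e0; apply: (sqmass_near Lg0 gL g0 _ cS t1 e0); exact: continuous_vertex_value.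
  - apply: is_derive_continuous; apply: is_derive_sqmass.
    by rewrite mulr_ge0 ?(ltW a0) ?(ltW T0).
  - exact: cZl.
  - by rewrite mulr_gt0.
apply: continuousD; first apply: continuousD.
- by apply: cM; [exact: continuous_slope_long|].
- rewrite (_ : (fun q => _) = (fun q => Q (vertex_value q) (slope_short q) ((2 * b) * time_to_max q))); last first.
    by apply/funext => x; rewrite mulrA.
  by apply: cM; [exact: continuous_slope_short|rewrite mulr_gt0].
apply: continuousM; first exact: cvg_cst.
apply: continuousB; first exact: cvg_cst.
apply: (@continuous_comp _ _ _ fst (soliton_mass)); first exact: cvg_fst.
by apply: is_derive_continuous; exact: is_derive_soliton_mass.
Qed.

Lemma continuous_mass_excess : {for q, continuous mass_excess}.
Proof.
apply: continuousB; last exact: cvg_cst.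
apply: continuousM; last exact: continuous_graph_mass.
apply: (@continuous_comp _ _ _ frequency (fun x => x `^ mass_exponent)).
  by apply: continuousM; [exact: cZl|exact: cvg_cst].
by apply: is_derive_continuous; apply: is_derive1_powR; exact: frequency_gt0.
Qed.

Lemma long_reflect x : 0 <= x <= 2 * time_to_max q ->
  Y (vertex_value q) (slope_long q) (2 * time_to_max q - x) = Y (vertex_value q) (slope_long q) x /\
  Z (vertex_value q) (slope_long q) (2 * time_to_max q - x) = - Z (vertex_value q) (slope_long q) x.
Proof.
apply: (newton_reflect Lg0 gL (ltW T0) (@newton_position _ _ _ Lg0 gL g0 _ _ _)).
by have [] := time_to_maxP dq.
Qed.

(** On the first half the solution increases from its positive value at the vertex,
    and the second half is a mirror image. *)
Lemma long_positive x : 0 <= x <= 2 * time_to_max q -> 0 < Y (vertex_value q) (slope_long q) x.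
Proof.
move=> xT; have c0 := vertex_value_gt0 q; have := xT; case/andP => x0 x2.
have [xle|xle] := leP x (time_to_max q).
  by apply: (lt_le_trans c0); apply: long_ge => //; rewrite x0.
have [<- _] := long_reflect xT; apply: (lt_le_trans c0); apply: long_ge => //.
by apply/andP; split; lra.
Qed.

Lemma graph_mass_le : q.2 <= 2 -> time_to_max q <= 1 -> graph_mass q <= 4 * cutoff ^+ 2 + 2 * soliton_mass_total.
Proof.
move=> q2 T1; have /andP[b0 b1'] := b01; have T0' := T0.
have hM s t : 0 <= t <= 2 -> (forall x, 0 <= x <= t -> 0 <= Y (vertex_value q) s x <= cutoff) ->
    Q (vertex_value q) s t <= 2 * cutoff ^+ 2.
  move=> /andP[t0 t2] h.
  have := @derive_le R (Q (vertex_value q) s) (fun x => Y (vertex_value q) s x ^+ 2) (fun x => cutoff ^+ 2 * x) (fun=> cutoff ^+ 2) 0 t t0.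
  rewrite sqmass0 subr0 mulr0 subr0 => hh.
  apply: (@le_trans _ _ (cutoff ^+ 2 * t)).
    apply: hh => x /andP[x0 xt]; [exact: is_derive_sqmass|exact: is_derive_linear|].
    have /andP[y0 yb] : 0 <= Y (vertex_value q) s x <= cutoff by apply: h; rewrite x0.
    by rewrite ler_sqr ?nnegrE // (le_trans y0).
  by rewrite mulrC ler_wpM2r ?sqr_ge0.
have h1 : Q (vertex_value q) (slope_long q) (2 * time_to_max q) <= 2 * cutoff ^+ 2.
  apply: hM; first by apply/andP; split; lra.
  move=> x /andP[x0 xT]; have xx : 0 <= x <= 2 * time_to_max q by rewrite x0.
  by rewrite (ltW (long_positive xx)) long_le_cutoff.
have h2 : Q (vertex_value q) (slope_short q) (2 * (b * time_to_max q)) <= 2 * cutoff ^+ 2.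
  apply: hM; first by apply/andP; split; nra.
  by move=> x /andP[x0 _]; rewrite (ltW (short_positive dq q2 x0)) short_le_cutoff.
have h3 : 0 <= soliton_mass q.1.
  by rewrite -(soliton_mass0); apply: (soliton_mass_nondec); case: dq => /ltW.
rewrite /graph_mass; lra.
Qed.

(** An upper bound of the velocity; the summand 1 makes it larger than its square
    root, which is the bound that the energy gives. *)
Definition speed : R := 1 + 8 * M0 ^+ 2 + 2 * pot 1.

Lemma speed_ge1 : 1 <= speed.
Proof.
have := potential_nondec p2 cutoff_ge1 (lexx 0) ler01 (lexx 1); rewrite {1}/potential prim0 => h.
by have := sqr_ge0 M0; rewrite /speed; lra.
Qed.

(** The maximum exceeds 1 and the velocity is bounded, so the solution is at least
    1/2 on a fixed interval before the maximum. *)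
Lemma graph_mass_ge : 1 / (2 * speed) <= time_to_max q -> 1 / (8 * speed) <= graph_mass q.
Proof.
move=> hT; have s1 := speed_ge1; have T0' := T0; have /andP[b0 b1'] := b01.
have [_ ZT _ YT] := time_to_maxP dq.
(* In time d the solution moves by at most 1/2. *)
set d := 1 / (2 * speed) in hT *.
have d0 : 0 < d by rewrite /d divr_gt0 //; lra.
have dS : speed * d = 1 / 2 by rewrite /d; field; rewrite gt_eqF //; lra.
have pot1 u : 0 <= u -> pot u <= pot 1.
  move=> u0; have [u1|u1] := leP u 1; first exact: (potential_nondec p2 cutoff_ge1).
  by apply: (potential_noninc p2 cutoff_ge1) => //; exact: ltW.
have Zs x : 0 <= x <= 2 * time_to_max q -> Z (vertex_value q) (slope_long q) x <= speed.
  move=> xx; have /andP[x0 _] := xx; have E := flow_energy (vertex_value q) (slope_long q) x0.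
  have := pot1 _ (ltW (long_positive xx)); have := long_energy dq.
  move: E; move: (Z _ _ x) (pot (Y _ _ _)) => z P E e1 P1.
  have : z ^+ 2 <= speed by rewrite /speed; lra.
  nra.
have Yh x : time_to_max q - d <= x <= time_to_max q -> 1 / 2 <= Y (vertex_value q) (slope_long q) x.
  move=> /andP[x1 x2].
  have := @derive_le R (Y (vertex_value q) (slope_long q)) (Z (vertex_value q) (slope_long q)) (fun x => speed * x) (fun=> speed) x (time_to_max q) x2.
  move=> h; have {h} : Y (vertex_value q) (slope_long q) (time_to_max q) - Y (vertex_value q) (slope_long q) x <= speed * time_to_max q - speed * x.
    apply: h => y /andP[y1 y2]; [|exact: is_derive_linear|].
      by apply: is_derive_position; lra.
    by apply: Zs; apply/andP; split; lra.
  have : speed * (time_to_max q - x) <= speed * d by rewrite ler_wpM2l; lra.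
  lra.
have Md : 1 / 4 * d <= Q (vertex_value q) (slope_long q) (time_to_max q) - Q (vertex_value q) (slope_long q) (time_to_max q - d).
  have Tdd : time_to_max q - d <= time_to_max q by lra.
  have := @derive_le R (fun x => 1 / 4 * x) (fun=> 1 / 4) (Q (vertex_value q) (slope_long q)) (fun x => Y (vertex_value q) (slope_long q) x ^+ 2) _ _ Tdd.
  move=> h; have {h} : 1 / 4 * time_to_max q - 1 / 4 * (time_to_max q - d) <=
      Q (vertex_value q) (slope_long q) (time_to_max q) - Q (vertex_value q) (slope_long q) (time_to_max q - d).
    apply: h => x /andP[x1 x2]; [exact: is_derive_linear|apply: is_derive_sqmass; lra|].
    have : 1 / 2 <= Y (vertex_value q) (slope_long q) x by apply: Yh; rewrite x1.
    nra.
  lra.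
have M1 : 0 <= Q (vertex_value q) (slope_long q) (time_to_max q - d).
  rewrite -(sqmass0 Lg0 gL g0 (vertex_value q) (slope_long q)); apply: sqmass_nondec => //; lra.
have M2 : Q (vertex_value q) (slope_long q) (time_to_max q) <= Q (vertex_value q) (slope_long q) (2 * time_to_max q).
  by apply: sqmass_nondec; lra.
have M3 : 0 <= Q (vertex_value q) (slope_short q) (2 * (b * time_to_max q)).
  rewrite -(sqmass0 Lg0 gL g0 (vertex_value q) (slope_short q)); apply: sqmass_nondec => //.
  by rewrite !mulr_ge0 // ltW.
have M4 := soliton_mass_le q.1.
have -> : 1 / (8 * speed) = 1 / 4 * d.
  by rewrite /d; field; rewrite gt_eqF //; lra.
rewrite /graph_mass; lra.
Qed.

End AtParameter.

Let powR_inv_mass_exponent x : 0 <= x -> (x `^ mass_exponent^-1) `^ mass_exponent = x.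
Proof. by move=> x0; rewrite -powRrM mulVf ?powRr1 // gt_eqF // mass_exponent_gt0. Qed.

(** At 0 the soliton is above 1 and its slope vanishes, so the time to the maximum
    tends to 0, uniformly in the fraction of slope. *)
Lemma excess_small (t1 : R) : 0 < t1 -> exists2 e, 0 < e < t1 &
  forall y, 1 / 2 <= y <= 2 -> mass_excess (e, y) <= 0.
Proof.
move=> t10; have m1 := soliton_max_gt1_kappa; have p2' := p2; have l0' := l0.
pose Bm := 4 * cutoff ^+ 2 + 2 * soliton_mass_total.
have Bm0 : 0 < Bm.
  have := soliton_mass_total_ge0; have : 0 < cutoff ^+ 2 by rewrite exprn_gt0 // (lt_le_trans ltr01 cutoff_ge1).
  rewrite /Bm; lra.
(* The frequency below which the mass is at most mu, given the bound Bm. *)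
pose A := (mu / Bm) `^ mass_exponent^-1.
have A0 : 0 < A by rewrite powR_gt0 // divr_gt0.
pose th := Num.min 1 (l / 2 * A).
have th0 : 0 < th by rewrite lt_min ltr01 mulr_gt0 ?divr_gt0.
have th1 : th <= 1 by rewrite ge_min lexx.
have thA : th <= l / 2 * A by rewrite ge_min lexx orbT.
pose d := (1 + M0) / 2.
have d1 : 1 < d by rewrite /d; lra.
pose eta := d * (d `^ (p - 2) - 1).
have eta0 : 0 < eta.
  rewrite /eta mulr_gt0 ?subr_gt0 //; first lra.
  have h := @gt0_ltr_powR _ (p - 2) _ 1 d; rewrite powR1 in h.
  by apply: h; rewrite ?nnegrE //; lra.
have [r1 r10 hr1] : exists2 r, 0 < r & forall y, `|0 - y| < r -> `|sol 0 - sol y| < (M0 - 1) / 2.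
  apply: continuous_near; last lra.
  exact: (is_derive_continuous (is_derive_soliton kappa_gt0 0)).
have [r2 r20 hr2] : exists2 r, 0 < r & forall y, `|0 - y| < r -> `|dsol 0 - dsol y| < eta * th / 3.
  apply: continuous_near; last by rewrite divr_gt0 // mulr_gt0.
  exact: (is_derive_continuous (is_derive_dsoliton kappa_gt0 0)).
pose e := Num.min t1 (Num.min r1 r2) / 2.
have min0 : 0 < Num.min t1 (Num.min r1 r2) by rewrite !lt_min t10 r10.
have [mt mr1 mr2] : [/\ Num.min t1 (Num.min r1 r2) <= t1, Num.min t1 (Num.min r1 r2) <= r1
    & Num.min t1 (Num.min r1 r2) <= r2] by split; rewrite !ge_min lexx ?orbT.
exists e; first by rewrite /e; apply/andP; split; lra.
move=> y /andP[y1 y2].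
have dq : admissible (e, y) by split => /=; [rewrite /e; lra|apply/andP; split; lra].
have hd : d <= vertex_value (e, y).
  have := hr1 e; rewrite ltr_norml ltr_norml (soliton0 kappa) => hh.
  have /andP[] : - ((M0 - 1) / 2) < M0 - sol e < (M0 - 1) / 2.
    by apply: hh; rewrite /e; apply/andP; split; lra.
  rewrite /vertex_value /d /=; lra.
have hs : 3 * tail_slope (e, y) <= eta * th.
  have := hr2 e; rewrite ltr_norml ltr_norml (dsoliton0 kappa) => hh.
  have /andP[] : - (eta * th / 3) < 0 - dsol e < eta * th / 3.
    by apply: hh; rewrite /e; apply/andP; split; lra.
  rewrite /tail_slope /=; lra.
have Tth : time_to_max (e, y) <= th.
  have := time_to_max_upper dq d1 hd; rewrite -/eta => h.
  by rewrite -(ler_pM2r eta0) mulrC [leRHS]mulrC; lra.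
have fA : frequency (e, y) <= A.
  by rewrite /frequency ler_pdivrMr //; lra.
have fe : frequency (e, y) `^ mass_exponent <= mu / Bm.
  rewrite -[leRHS]powR_inv_mass_exponent; last by rewrite ltW // divr_gt0.
  by apply: powR_le => //; rewrite ltW // ?mass_exponent_gt0 ?frequency_gt0.
have tB : graph_mass (e, y) <= Bm by apply: graph_mass_le => //; lra.
have fe0 : 0 <= frequency (e, y) `^ mass_exponent by exact: powR_ge0.
rewrite /mass_excess subr_le0.
apply: (@le_trans _ _ (frequency (e, y) `^ mass_exponent * Bm)); first by rewrite ler_wpM2l.
by rewrite -ler_pdivlMr.
Qed.

(** Far out the soliton is small, so the time to the maximum is long. *)
Lemma excess_large (t1 : R) : exists2 e, t1 < e &
  forall y, 1 / 2 <= y <= 2 -> 0 <= mass_excess (e, y).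
Proof.
have s1 := speed_ge1; have p2' := p2; have l0' := l0.
pose c := 1 / (8 * speed).
have c0 : 0 < c by rewrite /c divr_gt0 //; lra.
(* The frequency above which the mass is at least mu, given the bound c. *)
pose A := (mu / c) `^ mass_exponent^-1.
have A0 : 0 < A by rewrite powR_gt0 // divr_gt0.
pose Tn := Num.max (1 / (2 * speed)) (l / 2 * A).
have Tn1 : 1 / (2 * speed) <= Tn by rewrite le_max lexx.
have TnA : l / 2 * A <= Tn by rewrite le_max lexx orbT.
pose K := 9 + 4 * Lg.
have K0 : 0 < K by have := Lg0; rewrite /K; lra.
have [t t0 ht] := soliton_small (expR_gt0 (- (K * Tn))).
pose e := Num.max t1 t + 1.
have te1 : t1 < e by rewrite /e; have : t1 <= Num.max t1 t by [rewrite le_max lexx]; lra.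
have te : t < e by rewrite /e; have : t <= Num.max t1 t by [rewrite le_max lexx orbT]; lra.
exists e => // y /andP[y1 y2].
have dq : admissible (e, y) by split => /=; [lra|apply/andP; split; lra].
have TT : Tn < time_to_max (e, y).
  rewrite ltNge; apply/negP => h.
  have := time_to_max_lower dq; rewrite -/K leNgt => /negP; apply.
  have h1 : vertex_value (e, y) < expR (- (K * Tn)) by apply: ht; exact: ltW.
  apply: (@lt_le_trans _ _ (expR (- (K * Tn)) * expR (K * time_to_max (e, y)))).
    by rewrite ltr_pM2r ?expR_gt0.
  by rewrite -expRD -[leRHS]expR0 ler_expR addrC subr_le0 ler_pM2l.
have fA : A <= frequency (e, y) by rewrite /frequency ler_pdivlMr //; lra.
have fe : mu / c <= frequency (e, y) `^ mass_exponent.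
  rewrite -[leLHS]powR_inv_mass_exponent; last by rewrite ltW // divr_gt0.
  by apply: powR_le => //; rewrite ltW // mass_exponent_gt0.
have tc : c <= graph_mass (e, y) by apply: graph_mass_ge => //; lra.
rewrite /mass_excess subr_ge0.
apply: (@le_trans _ _ (frequency (e, y) `^ mass_exponent * c)); first by rewrite -ler_pdivrMr.
by rewrite ler_wpM2l // powR_ge0.
Qed.

Lemma short_end_slope_ge0 q : admissible q -> q.2 = 1 / 2 -> 0 <= short_end_slope q.
Proof.
move=> dq q2; have [T0 ZT Zpos _] := time_to_maxP dq; have /andP[b0 b1'] := b01.
rewrite /short_end_slope.
have -> : slope_short q = slope_long q by rewrite /slope_short /slope_long q2; congr (_ * _); field.
have : b * time_to_max q <= time_to_max q by rewrite -[leRHS]mul1r ler_wpM2r // ltW.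
rewrite le_eqVlt => /predU1P[->|h]; first by rewrite ZT.
by rewrite ltW // Zpos // h mulr_ge0 // ltW.
Qed.

(** The strict inequality at [q.2 = 2] excludes this value at the common zero. *)
Lemma exists_profile : exists q,
  [/\ admissible q, q.2 < 2, short_end_slope q = 0 & mass_excess q = 0].
Proof.
have /andP[b0 b1'] := b01.
have [t1 t10 ht1] : exists2 e : R, 1 < e &
  forall y, 1 / 2 <= y <= 2 -> 0 <= mass_excess (e, y) by exact: excess_large.
have [t0 /andP[t00 t01] ht0]  := excess_small ltr01.
have t01' : t0 < t1 by lra.
have h12 : 1 / 2 < 2 :> R by lra.
have rdom x y : t0 <= x <= t1 -> 1 / 2 <= y <= 2 -> admissible (x, y).
  by move=> /andP[x0 _] /andP[y0 y2]; split => /=; [lra|apply/andP; split; lra].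
have [] := @poincare_miranda R short_end_slope mass_excess t0 t1 (1 / 2) 2 t01' h12.
- by move=> [x y] [/= hx hy]; apply: continuous_short_end_slope; exact: rdom.
- by move=> [x y] [/= hx hy]; apply: continuous_mass_excess; exact: rdom.
- exact: ht0.
- exact: ht1.
- move=> x hx; apply: short_end_slope_ge0 => //; apply: rdom => //; lra.
- move=> x hx; apply/ltW/short_end => //; first by apply: rdom => //; lra.
  by rewrite mulr_ge0 // ltW //; have [] := @time_to_maxP (x, 2) (rdom _ _ hx _) => //; lra.
move=> [x y] [[/= hx hy] e1 e2]; exists (x, y); split => //=; first exact: rdom.
have /andP[_ y2] := hy; rewrite lt_def y2 andbT; apply/eqP => yE.
have dxy := rdom x y hx hy.
have bT : 0 <= b * time_to_max (x, y) by rewrite mulr_ge0 // ltW //; have [] := time_to_maxP dxy.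
by have := short_end dxy (esym yE) bT; rewrite -/(short_end_slope _) e1 ltxx.
Qed.

End Zero.

(** * Undoing the scaling *)

Section Scaling.
Variable r : R.
Hypothesis r0 : 0 < r.
(** The factor that turns the rescaled equation into one with [lambda = r ^ 2]. *)
Definition amplitude : R := r `^ kappa^-1.

Lemma amplitude_gt0 : 0 < amplitude. Proof. exact: powR_gt0. Qed.

Lemma amplitude_powR : amplitude `^ (p - 2) = r ^+ 2.
Proof.
rewrite /amplitude -powRrM; have -> : kappa^-1 * (p - 2) = 2%:R.
  by rewrite /kappa; field; rewrite subr_eq0 gt_eqF.
by rewrite powR_mulrn // ltW.
Qed.

Lemma amplitude_sqr : amplitude ^+ 2 / r = r `^ mass_exponent.
Proof.
rewrite /amplitude -powR_mulrn ?powR_ge0 // -powRrM -[X in _ / X]powRr1 ?(ltW r0) //.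
rewrite -powRB; last by rewrite (gt_eqF r0) implybT.
by congr (_ `^ _); rewrite /mass_exponent mulrC.
Qed.

Lemma is_derive_scale (f : R -> R) (a d s x : R) : is_derive (r * x + s) 1 f d ->
  is_derive x 1 (fun t => a * f (r * t + s)) (a * r * d).
Proof.
move=> df; rewrite -mulrA (mulrC r); apply: is_deriveZf.
exact: (@is_derive_compf R f (fun t => r * t + s) x _ _ df (is_derive_affine r s x)).
Qed.

Lemma scaled_nls (y z : R -> R) s (x : R) : 0 < y (r * x + s) <= cutoff ->
  is_derive (r * x + s) 1 y (z (r * x + s)) ->
  is_derive (r * x + s) 1 z (g (y (r * x + s))) ->
  [/\ 0 < amplitude * y (r * x + s),
      is_derive x 1 (fun t => amplitude * y (r * t + s)) (amplitude * r * z (r * x + s)) &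
      is_derive x 1 (fun t => amplitude * r * z (r * t + s))
        (r ^+ 2 * (amplitude * y (r * x + s)) - (amplitude * y (r * x + s)) `^ (p - 1))].
Proof.
move=> /andP[y0 yb] dy dz; split; first by rewrite mulr_gt0 ?amplitude_gt0.
  exact: is_derive_scale dy.
have h := is_derive_scale (amplitude * r) dz; apply: (is_derive_eq h).
rewrite forceE ?(ltW y0) // powRM ?(ltW y0) ?(ltW amplitude_gt0) //.
by rewrite (powRB1_split p2 amplitude_gt0) amplitude_powR; ring.
Qed.

Lemma scaled_edge c s L : (forall x, 0 <= x <= L -> 0 < Y c s x) ->
  (forall x, 0 <= x -> Y c s x <= cutoff) -> 0 <= L -> Z c s (L / 2) = 0 ->
  edge_profile p (r ^+ 2) (L / r) (amplitude * c) (amplitude * r * s) (amplitude ^+ 2 / r * Q c s L)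
    (fun x => amplitude * Y c s (r * x + 0)) (fun x => amplitude * r * Z c s (r * x + 0)).
Proof.
move=> Ypos Yb L0 Z0.
have rng x : 0 <= x <= L / r -> 0 <= r * x + 0 <= L.
  by move=> /andP[x0 xL]; rewrite addr0 mulr_ge0 ?(ltW r0) //= mulrC -ler_pdivlMr.
split.
- move=> x /=; rewrite in_itv /= => /rng rx; have /andP[rx0 _] := rx.
  by apply: scaled_nls; [rewrite Ypos // Yb|exact: is_derive_position|exact: is_derive_velocity].
- by rewrite mulr0 addr0 position0 velocity0.
- move=> x /rng; rewrite !addr0 => rx.
  have h0 : 0 <= L / 2 by rewrite divr_ge0.
  have L2 : 2 * (L / 2) = L by field.
  have := newton_reflect Lg0 gL h0 (@newton_position _ _ _ Lg0 gL g0 c s _) Z0.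
  rewrite L2 => /(_ _ rx) [e1 e2].
  have -> : r * (L / r - x) = L - r * x by field; rewrite gt_eqF.
  by rewrite e1 e2 mulrN.
exists (fun x => amplitude ^+ 2 / r * Q c s (r * x + 0)) => [x /rng /andP[rx0 _]|].
  have h := is_derive_scale (amplitude ^+ 2 / r) (is_derive_sqmass Lg0 gL g0 c s rx0).
  by apply: (is_derive_eq h); field; rewrite gt_eqF.
rewrite mulr0 !addr0 sqmass0 mulr0 subr0; congr (_ * Q c s _).
by field; rewrite gt_eqF.
Qed.

Lemma scaled_half_line t0 : 0 <= t0 ->
  half_line_profile p (r ^+ 2) (amplitude * sol t0) (amplitude * r * dsol t0)
   (amplitude ^+ 2 / r * (soliton_mass_total - soliton_mass t0))
   (fun x => amplitude * sol (r * x + t0)) (fun x => amplitude * r * dsol (r * x + t0)).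
Proof.
move=> t00; have a0 := amplitude_gt0; split.
- move=> x _; apply: scaled_nls; first by rewrite soliton_gt0 soliton_le_cutoff.
    exact: (is_derive_soliton kappa_gt0).
  rewrite (forceE p (soliton_range _)).
  have h := is_derive_dsoliton kappa_gt0 (r * x + t0); apply: (is_derive_eq h).
  by have -> : 2 * kappa + 1 = p - 1 by rewrite /kappa; field.
- by rewrite mulr0 add0r.
- exists r => x x0; rewrite normrM (ger0_norm (_ : 0 <= amplitude * r)) ?mulr_ge0 ?(ltW a0) ?(ltW r0) //.
  have -> : r * (amplitude * sol (r * x + t0)) = amplitude * r * sol (r * x + t0) by ring.
  apply: ler_wpM2l; first by rewrite mulr_ge0 // ltW.
  by apply: (dsoliton_norm kappa_gt0); rewrite addr_ge0 ?mulr_ge0 // ltW.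
exists (fun x => amplitude ^+ 2 / r * soliton_mass (r * x + t0)) => [x _|].
  have h := is_derive_scale (amplitude ^+ 2 / r) (is_derive_soliton_mass (r * x + t0)).
  by apply: (is_derive_eq h); field; rewrite gt_eqF.
rewrite mulr0 add0r -mulrDr addrC subrK.
apply: cvgM; first exact: cvg_cst.
apply: (@cvg_comp _ _ _ (fun x => r * x + t0) (soliton_mass) _ +oo); last exact: soliton_mass_cvg.
apply/cvgryPge => A; near=> x.
rewrite -lerBlDr mulrC -ler_pdivrMr //.
Unshelve. all: by end_near. Qed.

End Scaling.

(** The mass of the scaled profiles is [r ^ (2 / kappa - 1)] times that of the
    rescaled ones; the half-line counts twice because there are two of them. *)
Lemma profiles_exist (l l' mu : R) : p < 6 -> 0 < l' -> l' <= l -> 0 < mu ->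
  exists lam c s s' s0 M M' N,
  [/\ s + s' + s0 = 0, M + M' + (N + N) = mu,
      exists w z, edge_profile p lam l c s M w z,
      exists w z, edge_profile p lam l' c s' M' w z &
      exists w z, half_line_profile p lam c s0 N w z].
Proof.
move=> p6 l0 ll mu0; have L0 : 0 < l by exact: lt_le_trans ll.
pose b := l' / l.
have b01 : 0 < b <= 1 by rewrite /b divr_gt0 //= ler_pdivrMr // mul1r.
have [q [dq q2 F1 F2]] := exists_profile p6 L0 b01 mu0.
have [T0 ZT _ _] := time_to_maxP dq; have /andP[b0 b1] := b01.
set T := time_to_max q in T0 ZT.
pose r := frequency l q.
have r0 : 0 < r by exact: frequency_gt0.
have rE : r = 2 * T / l by [].
pose a := amplitude r; pose c := vertex_value q.
exists (r ^+ 2), (a * c), (a * r * slope_long q), (a * r * slope_short q),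
  (a * r * - tail_slope q), (a ^+ 2 / r * Q c (slope_long q) (2 * T)),
  (a ^+ 2 / r * Q c (slope_short q) (2 * (b * T))),
  (a ^+ 2 / r * (soliton_mass_total - soliton_mass q.1)).
split.
- by rewrite /slope_long /slope_short; ring.
- move/eqP: F2; rewrite subr_eq0 => /eqP <-.
  by rewrite -/r -amplitude_sqr // -/a /graph_mass -/T -/c; ring.
- have lE : l = 2 * T / r by rewrite rE; field; rewrite !gt_eqF.
  rewrite [X in edge_profile _ _ X]lE; do 2 eexists.
  apply: (@scaled_edge r r0 c (slope_long q) (2 * T)).
  + exact: long_positive.
  + by move=> x x0; exact: long_le_cutoff.
  + by rewrite mulr_ge0 // ltW.
  + by have -> : 2 * T / 2 = T by field.
- have lE : l' = 2 * (b * T) / r by rewrite rE /b; field; rewrite !gt_eqF.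
  rewrite lE; do 2 eexists.
  apply: (@scaled_edge r r0 c (slope_short q) (2 * (b * T))).
  + by move=> x /andP[x0 _]; apply: short_positive => //; exact: ltW.
  + by move=> x x0; apply: short_le_cutoff => //; exact: ltW.
  + by apply: mulr_ge0 => //; apply: mulr_ge0; apply: ltW.
  + by have -> : 2 * (b * T) / 2 = b * T by field.
do 2 eexists; rewrite opprK; apply: (scaled_half_line r0).
by case: dq => /ltW.
Qed.

End Profile.

Local Open Scope complex_scope.

(** * Real functions as complex-valued functions on an edge *)

Section RealToComplex.
Context {R : realType}.

Lemma norm_real_complex (x : R) : `|x%:C| = `|x|%:C.
Proof. by rewrite normc_def /= expr0n /= addr0 sqrtr_sqr. Qed.

Lemma normc_real (x : R) : Normc.normc x%:C = `|x|.
Proof. by rewrite /= expr0n /= addr0 sqrtr_sqr. Qed.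

Lemma cvg_real_complex (T : Type) (F : set_system T) (FF : Filter F) (f : T -> R) (l : R) :
  f @ F --> l -> (fun t => (f t)%:C : R[i]^o) @ F --> (l%:C : R[i]^o).
Proof.
move=> fl; apply/cvgrPdist_lt => e e0.
have [eI eR] : complex.Im e = 0 /\ 0 < complex.Re e.
  by move: e0; rewrite ltcE /= => /andP[/eqP -> ->].
have -> : e = (complex.Re e)%:C by move: eI; case: (e) => a b /= ->.
near=> t; rewrite -rmorphB norm_real_complex ltcR.
by near: t; exact: (@cvgr_dist_lt _ _ _ _ _ _ _ fl).
Unshelve. all: by end_near. Qed.

(** A two-sided derivative restricts to a derivative relative to any set. *)
Lemma is_derivative_on_real (I : set R) (w z : R -> R) :
  (forall x : R, I x -> is_derive x 1 w (z x)) ->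
  is_derivative_on I (fun x => (w x)%:C) (fun x => (z x)%:C).
Proof.
move=> dw x Ix; have /is_derive1_caratheodory[h [hE ch hx]] := dw x Ix.
apply: (@cvg_trans _ ((fun y => (h y)%:C : R[i]^o) @ x^')).
  apply: cvg_trans; last by apply: cvg_app; exact: cvg_within.
  apply: near_eq_cvg; apply: cvg_within.
  near=> y; have yx : y != x by near: y; exact: nbhs_dnbhs_neq.
  by rewrite -!rmorphB -fmorphV -rmorphM hE mulfK ?subr_eq0.
apply: cvg_real_complex; rewrite -hx.
exact: cvg_trans (cvg_app _ (@nbhs_dnbhs _ x)) ch.
Unshelve. all: by end_near. Qed.

Lemma within_continuous_real (I : set R) (w z : R -> R) :
  (forall x : R, I x -> is_derive x 1 w (z x)) ->
  {within I, continuous (fun x => (w x)%:C : R[i]^o)}.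
Proof.
move=> dw; apply: continuous_in_subspaceT => x /set_mem Ix.
by apply: cvg_real_complex; exact: is_derive_continuous (dw x Ix).
Qed.

Lemma sqL2norm_real (I : set R) (w : R -> R) :
  sqL2norm I (fun x => (w x)%:C) = (\int[lebesgue_measure]_(x in I) (w x ^+ 2)%:E)%E.
Proof.
by rewrite /sqL2norm; under eq_integral do rewrite normc_real real_normK ?num_real //.
Qed.

Lemma measurable_derivable (I : set R) (w z : R -> R) : measurable I ->
  (forall x : R, I x -> is_derive x 1 w (z x)) -> measurable_fun I w.
Proof.
move=> mI dw; apply: subspace_continuous_measurable_fun => //.
apply: continuous_in_subspaceT => x /set_mem Ix.
exact: is_derive_continuous (dw x Ix).
Qed.

Lemma L2_real (I : set R) (w z : R -> R) : measurable I ->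
  (forall x : R, I x -> is_derive x 1 w (z x)) ->
  (\int[lebesgue_measure]_(x in I) (w x ^+ 2)%:E < +oo)%E ->
  L2 I (fun x => (w x)%:C).
Proof.
move=> mI dw fin; split; [exact: measurable_derivable dw|exact: measurable_cst|].
by rewrite sqL2norm_real.
Qed.

Lemma derivable_LR (f g : R -> R) (a b : R) : a < b ->
  (forall x : R, a <= x <= b -> is_derive x 1 f (g x)) ->
  derivable_oo_LRcontinuous f a b /\ {in `]a, b[, derive1 f =1 g}.
Proof.
move=> ab df; split; first split.
- move=> x; rewrite in_itv /= => /andP[/ltW ax /ltW xb].
  by have [] := df x; rewrite ?ax.
- apply: cvg_at_right_filter; apply: (is_derive_continuous (a := g a)).
  by apply: df; rewrite lexx ltW.
- apply: cvg_at_left_filter; apply: (is_derive_continuous (a := g b)).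
  by apply: df; rewrite lexx ltW.
move=> x; rewrite in_itv /= => /andP[/ltW ax /ltW xb].
by rewrite derive1E; apply: derive_val; apply: df; rewrite ax.
Qed.

Lemma integral_segment (f F : R -> R) (a b : R) : a < b ->
  {within `[a, b], continuous f} ->
  (forall x : R, a <= x <= b -> is_derive x 1 F (f x)) ->
  (\int[lebesgue_measure]_(x in `[a, b]) (f x)%:E = (F b - F a)%:E)%E.
Proof.
move=> ab cf dF; have [h1 h2] := derivable_LR ab dF.
by rewrite (continuous_FTC2 ab cf h1 h2) EFinB.
Qed.

(** The test function and its derivative vanish outside a segment [[0, N]] and the
    test function also at its ends, so integration by parts over this segment has
    no boundary terms. *)
Lemma weak_derivative_real (I : set R) (w z dz : R -> R) :
  (forall phi, test_function I phi -> exists2 N, 0 < N &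
     [/\ `[0, N] `<=` I, phi 0 = 0, phi N = 0 &
      forall x, I x -> ~ `[0, N]%classic x -> phi x = 0 /\ derive1 phi x = 0]) ->
  (forall x : R, I x -> is_derive x 1 w (z x)) ->
  (forall x : R, I x -> is_derive x 1 z (dz x)) ->
  weak_derivative I (fun x => (w x)%:C) (fun x => (z x)%:C).
Proof.
move=> hN dw dz' phi tphi; have [N N0 [NI phi0 phiN out]] := hN phi tphi.
have [smooth _] := tphi.
have Nin (x : R) : 0 <= x <= N -> I x by move=> xN; apply: NI; rewrite /= in_itv.
have restr (h : R -> R) : (forall x, I x -> ~ `[0, N]%classic x -> h x = 0) ->
    (\int[lebesgue_measure]_(x in I) h x = \int[lebesgue_measure]_(x in `[0%R, N]) h x)%R.
  move=> hout; rewrite Rintegral_mkcond [RHS]Rintegral_mkcond; congr Rintegral.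
  apply/funext => x; rewrite !patchE.
  have [xN|xN] := boolP (x \in `[0, N]%classic).
    by rewrite (mem_set (NI _ (set_mem xN))).
  case: ifPn => // /set_mem Ix; apply: hout => //.
  by move/negP: xN => xN /mem_set.
rewrite /complex_integral.
have ReE (u v : R) : complex.Re (u%:C * v%:C) = u * v by rewrite -rmorphM.
have ImE (u v : R) : complex.Im (u%:C * v%:C) = 0 by rewrite -rmorphM.
have zero (h k : R -> R) : (\int[lebesgue_measure]_(x in I) complex.Im ((h x)%:C * (k x)%:C))%R = 0.
  rewrite (_ : (fun x => _) = cst 0); last by apply/funext => x; rewrite ImE.
  by rewrite /Rintegral integral0.
rewrite !zero.
rewrite (_ : (fun x => complex.Re _) = fun x => w x * derive1 phi x); last first.
  by apply/funext => x; rewrite ReE.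
rewrite (_ : (fun x => complex.Re ((z x)%:C * _)) = fun x => z x * phi x); last first.
  by apply/funext => x; rewrite ReE.
have dphi (x : R) : is_derive x 1 phi (derive1 phi x).
  by rewrite derive1E; apply: derivableP; exact: (smooth 0%N).
have cdphi : continuous (derive1 phi).
  move=> x; apply: differentiable_continuous; apply/derivable1_diffP.
  exact: (smooth 1%N).
have [w1 w2] := derivable_LR N0 (fun x h => dw x (Nin x h)).
have [p1 p2] := derivable_LR N0 (fun x _ => dphi x).
rewrite restr; last by move=> x Ix xN; have [_ ->] := out x Ix xN; rewrite mulr0.
rewrite (restr (fun x => z x * phi x)); last first.
  by move=> x Ix xN; have [-> _] := out x Ix xN; rewrite mulr0.
rewrite (@Rintegration_by_parts R w phi z (derive1 phi)) //.
- rewrite phi0 phiN !mulr0 subrr sub0r.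
  by rewrite -[X in _ = X]/(Complex _ _) oppr0.
- exact: (is_derive_within (fun x h => dz' x (Nin x h))).
- exact: continuous_subspaceT.
Qed.

End RealToComplex.

(** * Sobolev regularity on segments and half-lines *)

Section Edges.
Context {R : realType}.

Lemma not_interior (I : set R) (a : R) : (forall x, I x -> a <= x) -> ~ I° a.
Proof.
move=> aI; rewrite /interior => /nbhs_ballP[e /= e0 h].
have : I (a - e / 2).
  apply: h; rewrite /ball /= opprB addrC subrK ger0_norm; last by rewrite divr_ge0 // ltW.
  by rewrite ltr_pdivrMr // ltr_pMr // ltr1n.
by move=> /aI; rewrite lerBrDl gerDr leNgt divr_gt0.
Qed.

Lemma not_interior_right (I : set R) (b : R) : (forall x, I x -> x <= b) -> ~ I° b.
Proof.
move=> Ib; rewrite /interior => /nbhs_ballP[e /= e0 h].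
have : I (b + e / 2).
  apply: h; rewrite /ball /= opprD addrA subrr sub0r normrN ger0_norm; last by rewrite divr_ge0 // ltW.
  by rewrite ltr_pdivrMr // ltr_pMr // ltr1n.
by move=> /Ib; rewrite gerDl leNgt divr_gt0.
Qed.

Lemma test_vanish (I : set R) (phi : R -> R) (x : R) : test_function I phi -> ~ I° x -> phi x = 0.
Proof. by move=> [_ [K [_ KI out]]] Ix; apply: out => /KI. Qed.

Lemma test_segment (l : R) (phi : R -> R) : 0 < l -> test_function `[0, l] phi -> exists2 N, 0 < N &
     [/\ `[0, N]%classic `<=` `[0, l]%classic, phi 0 = 0, phi N = 0 &
      forall x, `[0, l]%classic x -> ~ `[0, N]%classic x -> phi x = 0 /\ derive1 phi x = 0].
Proof.
move=> l0 tphi; exists l => //; split => //.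
- apply: (test_vanish tphi); apply: not_interior => x /=.
  by rewrite in_itv /= => /andP[].
- apply: (test_vanish tphi); apply: not_interior_right => x /=.
  by rewrite in_itv /= => /andP[].
Qed.

Lemma test_half_line (phi : R -> R) : test_function `[0, +oo[ phi -> exists2 N : R, 0 < N &
     [/\ `[0, N]%classic `<=` `[0, +oo[%classic, phi 0 = 0, phi N = 0 &
      forall x, `[0, +oo[%classic x -> ~ `[0, N]%classic x -> phi x = 0 /\ derive1 phi x = 0].
Proof.
move=> tphi; have [_ [K [cK KI out]]] := tphi.
have [M [_ hM]] := compact_bounded cK.
(* The test function vanishes beyond A, hence together with its derivative
   beyond A + 1. *)
pose A := Num.max M 0 + 1.
have A0 : 0 < A by rewrite ltr_wpDl // le_max lexx orbT.
have big (x : R) : A < x -> phi x = 0.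
  move=> Ax; apply: out => Kx.
  have MA : M < A by rewrite ltr_pwDr // le_max lexx.
  have := hM A MA x Kx => /= h.
  by have := le_lt_trans (le_trans (ler_norm x) h) Ax; rewrite ltxx.
exists (A + 1); first by rewrite addr_gt0.
split.
- by move=> x /=; rewrite !in_itv /= => /andP[-> _].
- apply: (test_vanish tphi); apply: not_interior => x /=.
  by rewrite in_itv /= andbT.
- by apply: big; rewrite ltrDl.
move=> x /=; rewrite !in_itv /= andbT => x0; rewrite x0 /= => /negP; rewrite -ltNge => xN.
have Ax : A < x by lra.
split; first exact: big.
rewrite derive1E; apply: derive_val.
have : is_derive x 1 (fun _ : R => (0 : R)) 0 by exact: is_derive_cstf.
apply: near_eq_is_derive; near=> y; rewrite big //.
have : `|x - y| < x - A by near: y; apply: near_dist_lt; rewrite subr_gt0.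
by rewrite ltr_norml => /andP[]; lra.
Unshelve. all: by end_near. Qed.

Lemma H1_segment (l : R) (w z dz : R -> R) : 0 < l ->
  (forall x : R, `[0, l]%classic x -> is_derive x 1 w (z x)) ->
  (forall x : R, `[0, l]%classic x -> is_derive x 1 z (dz x)) ->
  H1 `[0, l] (fun x => (w x)%:C).
Proof.
move=> l0 dw dz'.
have fin (f df : R -> R) : (forall x : R, `[0, l]%classic x -> is_derive x 1 f (df x)) ->
    (\int[lebesgue_measure]_(x in `[0%R, l]) (f x ^+ 2)%:E < +oo)%E.
  move=> h; have cf : {within `[0, l], continuous (fun x => f x ^+ 2)}.
    apply: (@is_derive_within R _ (fun x => 2 * f x * df x)) => x x0.
    by apply: is_derive_sqr; apply: h; rewrite /= in_itv.
  have := continuous_compact_integrable (@segment_compact _ 0 l) cf.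
  by move=> /integrable_lty; apply.
split; first by apply: (L2_real _ dw) => //; exact: fin dw.
exists (fun x => (z x)%:C); split; first by apply: (L2_real _ dz') => //; exact: fin dz'.
apply: weak_derivative_real dw dz' => phi; exact: test_segment.
Qed.

Lemma integral_half_line (f F : R -> R) (M : R) : (forall x : R, 0 <= x -> 0 <= f x) ->
  {within `[0, +oo[, continuous f} ->
  (forall x : R, 0 <= x -> is_derive x 1 F (f x)) -> F x @[x --> +oo] --> F 0 + M ->
  (\int[lebesgue_measure]_(x in `[0%R, +oo[) (f x)%:E = M%:E)%E.
Proof.
move=> f0 cf dF Fl; rewrite (ge0_continuous_FTC2y f0 cf Fl) => //.
- by rewrite -EFinB addrC addKr.
- by move=> x /ltW x0; have [] := dF x x0.
- by apply: cvg_at_right_filter; apply: (is_derive_continuous (a := f 0)); exact: dF.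
- move=> x; rewrite in_itv /= andbT => /ltW x0.
  by rewrite derive1E; apply: derive_val; exact: dF.
Qed.

Lemma within_half_line (f df : R -> R) : (forall x : R, 0 <= x -> is_derive x 1 f (df x)) ->
  {within `[0, +oo[, continuous f}.
Proof.
move=> h; apply: continuous_in_subspaceT => x /set_mem /=; rewrite in_itv /= andbT => x0.
exact: is_derive_continuous (h x x0).
Qed.

(** The function is square integrable because [m] converges, and the derivative
    because it is dominated by the function. *)
Lemma H1_half_line (w z dz m : R -> R) (C M : R) :
  (forall x : R, 0 <= x -> is_derive x 1 w (z x)) ->
  (forall x : R, 0 <= x -> is_derive x 1 z (dz x)) ->
  (forall x, 0 <= x -> `|z x| <= C * w x) ->
  (forall x : R, 0 <= x -> is_derive x 1 m (w x ^+ 2)) ->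
  m x @[x --> +oo] --> m 0 + M ->
  H1 `[0, +oo[ (fun x => (w x)%:C).
Proof.
move=> dw dz' zC dm ml.
have dsq (a : R) (f df : R -> R) (h : forall x : R, 0 <= x -> is_derive x 1 f (df x)) :
    {within `[0, +oo[, continuous (fun x => a * f x ^+ 2)}.
  apply: (@within_half_line _ (fun x => a * (2 * f x * df x))) => x x0.
  by apply: is_deriveZf; apply: is_derive_sqr; exact: h.
have dw' (x : R) : `[0, +oo[%classic x -> is_derive x 1 w (z x).
  by rewrite /= in_itv /= andbT; exact: dw.
have dz'' (x : R) : `[0, +oo[%classic x -> is_derive x 1 z (dz x).
  by rewrite /= in_itv /= andbT; exact: dz'.
have finw a : 0 <= a -> (\int[lebesgue_measure]_(x in `[0%R, +oo[) (a * w x ^+ 2)%:E < +oo)%E.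
  move=> a0; have -> : (\int[lebesgue_measure]_(x in `[0%R, +oo[) (a * w x ^+ 2)%:E = (a * M)%:E)%E.
    apply: (@integral_half_line _ (fun x => a * m x)).
    - by move=> x _; rewrite mulr_ge0 // sqr_ge0.
    - exact: (dsq a w z).
    - by move=> x x0; apply: is_deriveZf; exact: dm.
    - by rewrite -mulrDr; apply: cvgM => //; exact: cvg_cst.
  exact: ltry.
split.
  apply: (L2_real _ dw') => //.
  have := finw 1 ler01; under eq_integral do rewrite mul1r; exact.
exists (fun x => (z x)%:C); split; last first.
  by apply: weak_derivative_real dw' dz'' => phi; exact: test_half_line.
apply: (L2_real _ dz'') => //.
apply: le_lt_trans (finw (C ^+ 2) (sqr_ge0 C)).
apply: ge0_le_integral => //.
- by move=> x _; rewrite lee_fin sqr_ge0.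
- apply/measurable_EFinP; apply: subspace_continuous_measurable_fun => //.
  have := dsq 1 z dz dz'; rewrite (_ : (fun x => 1 * z x ^+ 2) = (fun x => z x ^+ 2)) //.
  by apply/funext => x; rewrite mul1r.
- apply/measurable_EFinP; apply: subspace_continuous_measurable_fun => //.
  exact: (dsq _ w z).
move=> x; rewrite /= in_itv /= andbT => x0; rewrite lee_fin -exprMn.
rewrite -(real_normK (num_real (z x))) ler_sqr ?nnegrE //; first exact: zC.
exact: le_trans (normr_ge0 _) (zC x x0).
Qed.

End Edges.

(** * Assembling the bound state *)

Section Assembly.
Context {R : realType}.
Variables (l1 l2 : {posnum R}) (p mu lam c s0 M0 : R) (s M : bool -> R).
Variables (w z : bool -> R -> R) (y x : R -> R).
Hypothesis p2 : 2 < p.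
Hypothesis Hw : forall b : bool, edge_profile p lam (if b then l2 else l1)%:num c (s b) (M b) (w b) (z b).
Hypothesis Hy : half_line_profile p lam c s0 M0 y x.
Hypothesis Hs : s false + s true + s0 = 0.
Hypothesis HM : M false + M true + (M0 + M0) = mu.

Let G := double_bridge l1 l2.
Let acc (f : R -> R) t := lam * f t - f t `^ (p - 1).
Definition bridge_fun (f : bool -> R -> R) (h : R -> R) (e : edge G) (t : R) : R[i] :=
  match e with inl b => (f b t)%:C | inr _ => (h t)%:C end.

Let u := bridge_fun w y.
Let du := bridge_fun z x.
Let d2u := bridge_fun (fun b => acc (w b)) (acc y).

Let nls_edge (e : edge G) : exists f df,
  [/\ u e = (fun t => (f t)%:C), du e = (fun t => (df t)%:C),
     d2u e = (fun t => (acc f t)%:C) & nls_on p lam (edge_interval e) f df].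
Proof.
case: e => [b|h]; first by exists (w b), (z b); split => //; have [] := Hw b.
by exists y, x; split => //; have [] := Hy.
Qed.

Let dw (b : bool) (t : R) : 0 <= t <= (if b then l2 else l1)%:num -> is_derive t 1 (w b) (z b t).
Proof. by move=> tb; have [nls _ _ _] := Hw b; have [] := nls t; rewrite /= ?in_itv. Qed.

Let dz (b : bool) (t : R) : 0 <= t <= (if b then l2 else l1)%:num ->
  is_derive t 1 (z b) (acc (w b) t).
Proof. by move=> tb; have [nls _ _ _] := Hw b; have [] := nls t; rewrite /= ?in_itv. Qed.

Let dy (t : R) : 0 <= t -> is_derive t 1 y (x t).
Proof. by move=> t0; have [nls _ _ _] := Hy; have [] := nls t; rewrite /= ?in_itv /= ?t0. Qed.

Let dx (t : R) : 0 <= t -> is_derive t 1 x (acc y t).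
Proof. by move=> t0; have [nls _ _ _] := Hy; have [] := nls t; rewrite /= ?in_itv /= ?t0. Qed.

Let mass_edge (b : bool) : sqL2norm (edge_interval (inl b : edge G)) (u (inl b)) = (M b)%:E.
Proof.
have [_ _ _ [m dm <-]] := Hw b.
rewrite sqL2norm_real /= (@integral_segment _ _ m) //.
apply: (@is_derive_within R _ (fun t => 2 * w b t * z b t)) => t tb.
by apply: is_derive_sqr; exact: dw.
Qed.

Let mass_half_line (b : bool) : sqL2norm (edge_interval (inr b : edge G)) (u (inr b)) = M0%:E.
Proof.
have [_ _ _ [m dm ml]] := Hy.
rewrite sqL2norm_real /=; apply: (integral_half_line _ _ dm ml).
  by move=> t _; exact: sqr_ge0.
apply: (@within_half_line _ _ (fun t => 2 * y t * x t)) => t t0.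
by apply: is_derive_sqr; exact: dy.
Qed.

(** The profiles on the bounded edges are even, so both vertices see the same values
    and the same outgoing slopes, and the Kirchhoff conditions there are one and
    the same equation. *)
Lemma bound_state_of_profiles : exists u : edge G -> R -> R[i],
  [/\ bound_state p mu u, axis_symmetric u & everywhere_positive u].
Proof.
have p2' := p2.
exists u; split.
- split; first split.
  + split; first split.
    * move=> e; have [f [df [-> _ _ nls]]] := nls_edge e.
      by apply: (within_continuous_real (z := df)) => t /nls[].
    * exists (fun=> c%:C); split => [b|b|h] /=.
      - by have [_ [-> _] _ _] := Hw b.
      - have [_ [w0 _] sym _] := Hw b.
        have [|E _] := sym 0; first by rewrite lexx ltW.
        by move: E; rewrite subr0 => ->; rewrite w0.
      - by have [_ [-> _] _ _] := Hy.
    move=> [b|h] /=.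
      apply: (@H1_segment _ _ (w b) (z b) (acc (w b))) => // t; rewrite /= in_itv; [exact: dw|exact: dz].
    have [_ _ [C zC] [m dm ml]] := Hy.
    exact: (H1_half_line dy dx zC dm ml).
  have -> : mass u = ((\sum_(b : bool) (M b)%:E) + (\sum_(b : bool) M0%:E))%E.
    rewrite /mass big_sumType; congr (_ + _)%E; apply: eq_bigr => b _.
      exact: mass_edge.
    exact: mass_half_line.
  by rewrite !big_bool /= -!EFinD -HM (addrC (M false)).
- exists lam, du, d2u; split.
  + move=> e; have [f [df [-> -> _ nls]]] := nls_edge e.
    by apply: is_derivative_on_real => t /nls[].
  + move=> e; have [f [df [_ -> -> nls]]] := nls_edge e.
    by apply: is_derivative_on_real => t /nls[].
  + move=> e t te; have [f [df [-> _ -> nls]]] := nls_edge e.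
    have [f0 _ _] := nls t te.
    rewrite normc_real gtr0_norm // -!rmorphM -rmorphD; congr (_ %:C).
    rewrite mulrC; have -> : p - 2 = p - 1 - 1 by ring.
    by rewrite mulr_powRB1 ?(ltW f0) // /acc ?subrK //; lra.
  + have z0 b : z b 0 = s b by have [_ [_ ->] _ _] := Hw b.
    have zl b : z b (if b then l2 else l1)%:num = - s b.
      have [_ _ sym _] := Hw b; have [|_ h] := sym 0; first by rewrite lexx ltW.
      by rewrite -(z0 b) -h subr0.
    have x0 : x 0 = s0 by have [_ [_ ->] _ _] := Hy.
    move=> v; rewrite /kirchhoff.
    rewrite big_mkcond big_bool /= [X in _ - X]big_mkcond big_bool /=.
    rewrite big_mkcond big_bool /=.
    have /= zt := zl true; have /= zf := zl false.
    have sum0 : (s true)%:C + (s false)%:C + s0%:C = 0 :> R[i].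
      by rewrite -!rmorphD (addrC (s true)) Hs.
    case: v => /=; rewrite ?zt ?zf ?z0 x0 ?rmorphN -[RHS]sum0; ring.
- move=> [b|h] t /=; rewrite in_itv /= => tb //.
  by have [_ _ sym _] := Hw b; have [-> _] := sym t tb.
move=> e t te; have [f [df [-> _ _ nls]]] := nls_edge e.
by rewrite ltcR; have [] := nls t te.
Qed.

End Assembly.

Unset Implicit Arguments.

Theorem proposition5p1 (R : realType) (l1 l2 : {posnum R}) (p : R)
    (p_gt2 : 2 < p) (p_lt6 : p < 6) (mu : R) (mu_gt0 : 0 < mu) :
  exists u : edge (double_bridge l1 l2) -> R -> R[i],
    [/\ bound_state p mu u, axis_symmetric u & everywhere_positive u].
Proof.
have [l21|l12] := leP l2%:num l1%:num.
  have [lam [c [s [s' [s0 [M [M' [M0 [hs hM [w [z hw]] [w' [z' hw']] [y [x hy]]]]]]]]]]] :=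
    profiles_exist p_gt2 p_lt6 (gt0 l2) l21 mu_gt0.
  apply: (@bound_state_of_profiles R l1 l2 p mu lam c s0 M0 (fun b => if b then s' else s)
    (fun b => if b then M' else M) (fun b => if b then w' else w)
    (fun b => if b then z' else z) y x) => //.
  by case.
have [lam [c [s [s' [s0 [M [M' [M0 [hs hM [w [z hw]] [w' [z' hw']] [y [x hy]]]]]]]]]]] :=
  profiles_exist p_gt2 p_lt6 (gt0 l1) (ltW l12) mu_gt0.
apply: (@bound_state_of_profiles R l1 l2 p mu lam c s0 M0 (fun b => if b then s else s')
  (fun b => if b then M else M') (fun b => if b then w else w')
  (fun b => if b then z else z') y x) => //.
- by case.
- by rewrite (addrC s').
by rewrite (addrC M').
Qed.
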